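(* Let $N\ge1$. Let $f$ be holomorphic in $\{z\in\mathbb{C}:\Re z>-\epsilon\}$ for some $\epsilon>0$, with $f(0)=1$. Then $$\mathsf{P}_f^{(N+1)}\Lambda_{N+1,N}=\Lambda_{N+1,N}\mathsf{P}_f^{(N)},$$ as kernels from $\mathbb{W}_{N+1}$ to $\mathbb{W}_N$.
   Context: $\mathbb{Z}_+=\{0,1,2,\dots\}$. $\mathbf a=(a_x)_{x\in\mathbb{Z}_+}$ is a fixed real sequence with $\inf_xa_x>0$, $\sup_xa_x<\infty$. $p_0(z)=1$, $p_x(z)=\prod_{k=0}^{x-1}(1-z/a_k)$. $\mathsf{T}_f(x,y)=-\frac{1}{2\pi \mathrm{i}}\frac{1}{a_y}\oint_{\mathsf{C}_{\mathbf a}}\frac{p_x(w)}{p_{y+1}(w)}f(w)dw$, $x,y\in\mathbb{Z}_+$, where $\mathsf{C}_{\mathbf a}\subset\{\Re z>-\epsilon\}$ is a positively oriented contour encircling all points $a_x$. $\mathbb{W}_N=\{(x_1,\dots,x_N)\in\mathbb{Z}_+^N:x_1<\dots<x_N\}$. For $\mathbf x\in\mathbb{W}_N,\mathbf y\in\mathbb{W}_{N+1}$, $\mathbf x\prec\mathbf y$ means $y_1\le x_1<y_2\le x_2<\dots<y_N\le x_N<y_{N+1}$. $\mathsf{P}_f^{(N)}(\mathbf x,\mathbf y)=\det(\mathsf{T}_f(x_i,y_j))_{i,j=1}^N$ for $\mathbf x,\mathbf y\in\mathbb{W}_N$; $\Lambda_{N+1,N}(\mathbf y,\mathbf x)=\prod_{i=1}^Na_{x_i}^{-1}\,\mathbf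 1_{\mathbf x\prec\mathbf y}$ for $\mathbf x\in\mathbb{W}_N$, $\mathbf y\in\mathbb{W}_{N+1}$. Products of kernels are compositions: $(AB)(\mathbf y,\mathbf x)=\sum_{\mathbf z}A(\mathbf y,\mathbf z)B(\mathbf z,\mathbf x)$. *)

(* Defs.v *)
From HB Require Import structures.
From mathcomp Require Import all_boot all_order all_algebra.
From mathcomp Require Import all_classical all_reals all_analysis.
From mathcomp Require Import complex.
(* Not imported: its absolute summability predicate would shadow that of esum;
   only the unordered sum [summability.sum] is needed. *)
From mathcomp Require summability.

Set Implicit Arguments.
Unset Strict Implicit.
Unset Printing Implicit Defensive.

Import Order.TTheory GRing.Theory Num.Theory.
Import numFieldNormedType.Exports.

Local Open Scope classical_set_scope.
Local Open Scope ring_scope.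
Local Open Scope complex_scope.

Section ComplexAnalysis.
Context {R : realType}.

Definition right_half_plane (eps : R) : set R[i] :=
  [set z | - eps < complex.Re z].

(* The regular module R[i]^o over the field R[i] makes this complex (not real)
   differentiability. *)
Definition holomorphic_on (U : set R[i]) (f : R[i] -> R[i]) : Prop :=
  forall z, U z -> derivable (f : R[i]^o -> R[i]^o) z 1.

(* Curves are parametrized by [0, 1]; values outside [0, 1] are irrelevant. *)
Definition curve_image (gamma : R -> R[i]) : set R[i] := gamma @` `[0, 1].

Definition curve_deriv (gamma : R -> R[i]) (t : R) : R[i] :=
  derive1 (fun s => complex.Re (gamma s)) t +i* derive1 (fun s => complex.Im (gamma s)) t.

Definition contour_integral (gamma : R -> R[i]) (g : R[i] -> R[i]) : R[i] :=
  let h t := g (gamma t) * curve_deriv gamma t in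
  (\int[lebesgue_measure]_(t in `[0, 1]) complex.Re (h t))
  +i* (\int[lebesgue_measure]_(t in `[0, 1]) complex.Im (h t)).

(* C^1 up to the boundary: the derivative on the open interval extends
   continuously to [c, d]. *)
Definition C1_on_segment (c d : R) (u : R -> R) : Prop :=
  derivable_oo_LRcontinuous u c d /\
  exists2 v : R -> R,
    {within `[c, d], continuous v} & {in `]c, d[, derive1 u =1 v}.

Definition piecewise_C1 (gamma : R -> R[i]) : Prop :=
  exists2 ts : seq R, itv_partition 0 1 ts &
    forall k, (k < size ts)%N ->
      C1_on_segment (nth 0 (0 :: ts) k) (nth 0 ts k) (fun s => complex.Re (gamma s)) /\
      C1_on_segment (nth 0 (0 :: ts) k) (nth 0 ts k) (fun s => complex.Im (gamma s)).

Definition simple_closed_contour (gamma : R -> R[i]) : Prop :=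
  [/\ piecewise_C1 gamma, gamma 0 = gamma 1 & {in `[0, 1[ &, injective gamma}].

Definition two_pi_i : R[i] := 0 +i* (2 * pi).

Definition winding_number (gamma : R -> R[i]) (c : R[i]) : R[i] :=
  two_pi_i^-1 * contour_integral gamma (fun w => (w - c)^-1).

(* A simple closed contour has winding number 1 about the points it encircles
   when positively oriented, -1 when negatively oriented, and 0 about the points
   outside. *)
Definition positively_encircles (gamma : R -> R[i]) (c : R[i]) : Prop :=
  ~ curve_image gamma c /\ winding_number gamma c = 1.

End ComplexAnalysis.

Definition W (N : nat) : Type := {x : N.-tuple nat | sorted ltn x}.
HB.instance Definition _ N := Countable.on (W N).

Definition wcoord N (x : W N) (i : 'I_N) : nat := tnth (val x) i.

Definition interlace N (x : W N) (y : W N.+1) : bool :=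
  [forall i : 'I_N,
     (wcoord y (widen_ord (leqnSn N) i) <= wcoord x i < wcoord y (lift ord0 i))%N].

Section Kernels.
Context {R : realType}.

(* [summability.sum] is the limit of the finite partial sums and takes a default
   value when it does not exist; [kernel_composable] says that all the sums in
   [kernel_comp A B] converge absolutely. *)
Definition kernel_composable (I J K : choiceType)
    (A : I -> J -> R[i]) (B : J -> K -> R[i]) : Prop :=
  forall y x, summable [set: J] (fun z => (Normc.normc (A y z * B z x))%:E).

Definition kernel_comp (I J K : choiceType)
    (A : I -> J -> R[i]) (B : J -> K -> R[i]) (y : I) (x : K) : R[i] :=
  summability.sum (fun z => A y z * B z x : R[i]^o).

Variables (a : nat -> R) (f : R[i] -> R[i]) (gamma : R -> R[i]).

Definition p_poly (x : nat) (z : R[i]) : R[i] := \prod_(k < x) (1 - z / (a k)%:C).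

Definition T_kernel (x y : nat) : R[i] :=
  - two_pi_i^-1 * ((a y)%:C)^-1 *
  contour_integral gamma (fun w => p_poly x w / p_poly y.+1 w * f w).

Definition P_kernel (N : nat) (x y : W N) : R[i] :=
  \det (\matrix_(i < N, j < N) T_kernel (wcoord x i) (wcoord y j)).

Definition Lambda (N : nat) (y : W N.+1) (x : W N) : R[i] :=
  (\prod_(i < N) ((a (wcoord x i))%:C)^-1) * (interlace x y)%:R.

End Kernels.

(* Main.v *)
Require Import Defs.
From HB Require Import structures.
From mathcomp Require Import all_boot all_order all_algebra.
From mathcomp Require Import all_classical all_reals all_analysis.
From mathcomp Require Import complex.
From mathcomp Require Import perm finmap measurable_realfun ring lra.
Import Order.TTheory GRing.Theory Num.Theory.
Import numFieldNormedType.Exports.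

(* Write T f x y for the one-particle kernel.  Since multiplying the integrand by
   w acts on 1/p_{y+1} as a difference in y, and p_{x+1} - p_x = -(w/a_x) p_x, one
   has sum_{z <= m} (T f (x+1) z - T f x z) = -(a_m/a_x) T f x m as soon as
   the integrals of p_x f along the contour vanish.  Expanding the determinants
   column by column, P Lambda becomes the determinant of the sums of T f y_i z
   over the intervals cut out by x.  Column operations turn these into the
   cumulative sums over z <= x_j, with a last column equal to sum_z T f y_i z = 1;
   then subtracting consecutive rows and applying the relation above gives the
   determinant of the sums of T f z x_j / a_z over y_i <= z < y_{i+1}, which is
   Lambda P.

   The analytic input (vanishing of those integrals, absolute summability of T f x,
   and sum_z T f x z = f 0) comes from a power series f = sum_n e_n (1 - z/c)^n
   that converges geometrically on a disc around a large c which contains 0 and the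
   contour: for the polynomial (1 - z/c)^n the kernel T is the n-step transition
   probability of a chain jumping from y to y+1 with probability a_y/c.  The
   power series is obtained from Goursat's theorem on a square centred at c, whose
   boundary can replace a circle because all its points are at distance at least
   half its side from c. *)

Local Open Scope classical_set_scope.
Local Open Scope ring_scope.
Local Open Scope complex_scope.

Set Implicit Arguments.
Unset Strict Implicit.
Unset Printing Implicit Defensive.

(** About the curve only its winding numbers around the points [a x] are known, so it is never
    deformed. What can be integrated along it exactly are functions with a primitive near the curve
    and the simple poles [(w - a x)^-1]. With partial fractions this settles polynomial [f], and
    uniform approximation on the curve transfers the result to holomorphic [f].

    Powers of [1 - z/c] are preferred to monomials for two reasons. For [c] above all [a x] their
    kernels are genuine transition probabilities, so row sums of absolute values are bounded by the
    sum of the [normc (e n)], however many columns are summed. And each power equals 1 at [z = 0],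
    matching total mass 1, so the row sum of [T f] is the sum of the [e n], that is [f 0]. The
    expansion must therefore converge at 0, at distance [c] from the centre, while the square of
    half side [r] must stay in the half plane: hence [c <= rho < r < c + eps].

    Only one side of the identity is an infinite sum: in [P Lambda] the last coordinate of the
    intermediate configuration has no upper bound, whereas in [Lambda P] interlacing bounds every
    coordinate. *)

Local Notation Re := complex.Re.
Local Notation Im := complex.Im.
Local Notation normc := Normc.normc.

(** * Segment integrals of complex-valued functions *)

Section ComplexBasics.
Context {R : rcfType}.
Implicit Types z w : R[i].

Lemma ReD z w : Re (z + w) = Re z + Re w. Proof. by case: z; case: w. Qed.
Lemma ImD z w : Im (z + w) = Im z + Im w. Proof. by case: z; case: w. Qed.
Lemma ReN z : Re (- z) = - Re z. Proof. by case: z. Qed.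
Lemma ImN z : Im (- z) = - Im z. Proof. by case: z. Qed.
Lemma ReB z w : Re (z - w) = Re z - Re w. Proof. by rewrite ReD ReN. Qed.
Lemma ImB z w : Im (z - w) = Im z - Im w. Proof. by rewrite ImD ImN. Qed.
Lemma ReM z w : Re (z * w) = Re z * Re w - Im z * Im w.
Proof. by case: z; case: w. Qed.
Lemma ImM z w : Im (z * w) = Re z * Im w + Im z * Re w.
Proof. by case: z => a b; case: w => c d. Qed.
Lemma ReV z : Re z^-1 = Re z / (Re z ^+ 2 + Im z ^+ 2). Proof. by case: z. Qed.
Lemma ImV z : Im z^-1 = - (Im z / (Re z ^+ 2 + Im z ^+ 2)). Proof. by case: z. Qed.
Definition ReImE := (ReB, ImB, ReD, ImD, ReN, ImN, ReM, ImM).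

Lemma eqc z w : Re z = Re w -> Im z = Im w -> z = w.
Proof. by case: z w => a b [c d] /= -> ->. Qed.

Lemma normcD z w : normc (z + w) <= normc z + normc w.
Proof. exact: le_normcD. Qed.

Lemma normcB z w : normc (z - w) = normc (w - z).
Proof. by rewrite -normcN opprB. Qed.

Lemma normc_ge0 z : 0 <= normc z.
Proof. by case: z => a b; rewrite sqrtr_ge0. Qed.

Lemma normc_sqr z : normc z ^+ 2 = Re z ^+ 2 + Im z ^+ 2.
Proof. by case: z => a b; rewrite /= sqr_sqrtr// addr_ge0// sqr_ge0. Qed.

Lemma normcX z n : normc (z ^+ n) = normc z ^+ n.
Proof.
elim: n => [|n ih]; first by rewrite !expr0 Normc.normc1.
by rewrite !exprS Normc.normcM ih.
Qed.

Lemma normc_eq0 z : (normc z == 0) = (z == 0).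
Proof.
by apply/eqP/eqP => [/Normc.eq0_normc //|->]; rewrite Normc.normc0.
Qed.

Lemma normc_gt0 z : (0 < normc z) = (z != 0).
Proof. by rewrite lt_neqAle normc_ge0 andbT eq_sym normc_eq0. Qed.

Lemma normc_real (x : R) : normc x%:C = `|x|.
Proof. by rewrite /= expr0n /= addr0 sqrtr_sqr. Qed.

Lemma sqr_le_norm (x y : R) : 0 <= y -> x ^+ 2 <= y ^+ 2 -> `|x| <= y.
Proof. by move=> y0; rewrite -real_normK ?num_real// ler_sqr. Qed.

Lemma Re_le_normc z : `|Re z| <= normc z.
Proof.
by apply: sqr_le_norm; rewrite ?normc_ge0// normc_sqr lerDl sqr_ge0.
Qed.

Lemma Im_le_normc z : `|Im z| <= normc z.
Proof.
by apply: sqr_le_norm; rewrite ?normc_ge0// normc_sqr lerDr sqr_ge0.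
Qed.

Lemma normc_le_ReIm z : normc z <= `|Re z| + `|Im z|.
Proof.
rewrite -ler_sqr ?nnegrE ?addr_ge0 ?normc_ge0//.
rewrite normc_sqr sqrrD !real_normK ?num_real//.
by rewrite addrAC lerDl mulrn_wge0// mulr_ge0.
Qed.

Lemma normc_sum (I : Type) (r : seq I) (P : pred I) (F : I -> R[i]) :
  normc (\sum_(i <- r | P i) F i) <= \sum_(i <- r | P i) normc (F i).
Proof.
elim/big_rec2 : _ => [|i x y _ ih]; first by rewrite Normc.normc0.
by rewrite (le_trans (normcD _ _))// lerD2l.
Qed.

Lemma normc_prod (I : Type) (r : seq I) (P : pred I) (F : I -> R[i]) :
  normc (\prod_(i <- r | P i) F i) = \prod_(i <- r | P i) normc (F i).
Proof. by apply: (big_morph _ (@Normc.normcM R) (@Normc.normc1 R)). Qed.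

End ComplexBasics.

Section SegmentIntegral.
Context {R : realType}.
Implicit Types (a b t : R) (h k : R -> R[i]) (z : R[i]).
Local Notation mu := (@lebesgue_measure R).

Definition cint a b h : R[i] :=
  (\int[mu]_(t in `[a, b]) Re (h t)) +i* (\int[mu]_(t in `[a, b]) Im (h t)).

Definition cintegrable a b h :=
  mu.-integrable `[a, b] (EFin \o (fun t => Re (h t))) /\
  mu.-integrable `[a, b] (EFin \o (fun t => Im (h t))).

Definition ccont (A : set R) h :=
  {within A, continuous (fun t => Re (h t))} /\
  {within A, continuous (fun t => Im (h t))}.

Lemma eq_cint a b h k : {in `[a, b], h =1 k} -> cint a b h = cint a b k.
Proof.
move=> hk; congr (_ +i* _); apply: eq_Rintegral => t /set_mem /= tab;
by rewrite hk.
Qed.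

Lemma eq_cintegrable a b h k : {in `[a, b], h =1 k} ->
  cintegrable a b h -> cintegrable a b k.
Proof.
move=> hk [h1 h2]; split.
  apply: eq_integrable h1 => // t /set_mem /= tab; by rewrite /= hk.
apply: eq_integrable h2 => // t /set_mem /= tab; by rewrite /= hk.
Qed.

Lemma cintegrableD a b h k : cintegrable a b h -> cintegrable a b k ->
  cintegrable a b (fun t => h t + k t).
Proof.
move=> [h1 h2] [k1 k2]; split.
  apply: eq_integrable (integrableD _ h1 k1) => // t _; by rewrite /= ReD.
apply: eq_integrable (integrableD _ h2 k2) => // t _; by rewrite /= ImD.
Qed.

Lemma cintD a b h k : cintegrable a b h -> cintegrable a b k ->
  cint a b (fun t => h t + k t) = cint a b h + cint a b k.
Proof.
move=> [h1 h2] [k1 k2]; rewrite /cint.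
under [in LHS]eq_Rintegral do rewrite ReD.
rewrite RintegralD//; congr (_ +i* _).
under [in LHS]eq_Rintegral do rewrite ImD.
by rewrite RintegralD.
Qed.

Lemma cintegrableZ a b z h : cintegrable a b h ->
  cintegrable a b (fun t => z * h t).
Proof.
move=> [h1 h2]; split.
  apply: eq_integrable (integrableB _ (integrableZl _ (Re z) h1)
    (integrableZl _ (Im z) h2)) => // t _; by rewrite /= ReM.
apply: eq_integrable (integrableD _ (integrableZl _ (Re z) h2)
    (integrableZl _ (Im z) h1)) => // t _; by rewrite /= ImM.
Qed.

Lemma cintZ a b z h : cintegrable a b h ->
  cint a b (fun t => z * h t) = z * cint a b h.
Proof.
move=> [h1 h2].
have Z (c : R) (k : R -> R) : mu.-integrable `[a, b] (EFin \o k) ->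
    mu.-integrable `[a, b] (EFin \o (fun t => c * k t)).
  by move=> ki; apply: eq_integrable (integrableZl _ c ki).
apply: eqc => /=.
  under eq_Rintegral do rewrite ReM.
  by rewrite RintegralB ?RintegralZl ?ReM//; exact: Z.
under eq_Rintegral do rewrite ImM.
by rewrite RintegralD ?RintegralZl ?ImM//; exact: Z.
Qed.

Lemma cintN a b h : cintegrable a b h -> cint a b (fun t => - h t) = - cint a b h.
Proof.
move=> hi; rewrite -mulN1r -cintZ//; apply: eq_cint => t _.
by rewrite mulN1r.
Qed.

Lemma cintB a b h k : cintegrable a b h -> cintegrable a b k ->
  cint a b (fun t => h t - k t) = cint a b h - cint a b k.
Proof.
move=> hi ki; rewrite -mulN1r -cintZ// -cintD//; last exact: cintegrableZ.
by apply: eq_cint => t _; rewrite mulN1r.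
Qed.

Lemma cintegrable_sum a b (n : nat) (F : nat -> R -> R[i]) :
  (forall i, (i < n)%N -> cintegrable a b (F i)) ->
  cintegrable a b (fun t => \sum_(i < n) F i t).
Proof.
elim: n => [|n ih] Fi.
  apply: (@eq_cintegrable a b (fun=> 0)) => [t _|]; first by rewrite big_ord0.
  split; apply: eq_integrable (integrable0 _ _) => //.
apply: (@eq_cintegrable a b (fun t => \sum_(i < n) F i t + F n t)).
  by move=> t _; rewrite big_ord_recr.
by apply: cintegrableD; [apply: ih => i /ltnW; exact: Fi|exact: Fi].
Qed.

Lemma cint0 a b : cint a b (fun=> 0) = 0.
Proof.
have Z : \int[mu]_(t in `[a, b]) (0 : R) = 0 by rewrite Rintegral_cst// mul0r.
by apply: eqc; rewrite /= Z.
Qed.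

Lemma cint_sum a b (n : nat) (F : nat -> R -> R[i]) :
  (forall i, (i < n)%N -> cintegrable a b (F i)) ->
  cint a b (fun t => \sum_(i < n) F i t) = \sum_(i < n) cint a b (F i).
Proof.
elim: n => [|n ih] Fi.
  rewrite big_ord0 -[RHS](cint0 a b); apply: eq_cint => t _.
  by rewrite big_ord0.
rewrite big_ord_recr /= -ih; last by move=> i /ltnW; exact: Fi.
rewrite -cintD; last exact: Fi.
  by apply: eq_cint => t _; rewrite big_ord_recr.
by apply: cintegrable_sum => i /ltnW; exact: Fi.
Qed.

Lemma integrable_itv_split a b c (f : R -> R) : a <= b -> b <= c ->
  mu.-integrable `[a, b] (EFin \o f) -> mu.-integrable `[b, c] (EFin \o f) ->
  mu.-integrable `[a, c] (EFin \o f).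
Proof.
move=> ab bc fab fbc.
have E : `[a, c]%classic = `[a, b]%classic `|` `]b, c]%classic.
  by apply: itv_bndbnd_setU; rewrite bnd_simp.
have fbc' : mu.-integrable `]b, c] (EFin \o f).
  apply: integrableS fbc => // t /=; rewrite !in_itv/=.
  by move=> /andP[/ltW -> ->].
have /integrableP[mab' _] := integrable_abse fab.
have /integrableP[mbc' _] := integrable_abse fbc'.
case/integrableP: fab => mab iab; case/integrableP: fbc' => mbc ibc.
apply/integrableP; rewrite E; split; first by apply/measurable_funU.
rewrite ge0_integral_setU//.
- exact: lte_add_pinfty.
- by apply/measurable_funU.
- apply/disj_setPS => y [/=]; rewrite 2!in_itv/= => /andP[_ yx] /andP[].
  by rewrite ltNge yx.
Qed.

Lemma Rintegral_itv_split a b c (f : R -> R) : a <= b -> b <= c ->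
  mu.-integrable `[a, c] (EFin \o f) ->
  \int[mu]_(t in `[a, c]) f t =
    \int[mu]_(t in `[a, b]) f t + \int[mu]_(t in `[b, c]) f t.
Proof.
move=> ab bc fac.
have /= := Rintegral_itvB fac (x := b).
rewrite !bnd_simp => /(_ ab bc) E.
rewrite -(@Rintegral_itv_obnd_cbnd R b); first by rewrite -E; ring.
apply: integrableS fac => // t /=; rewrite !in_itv/= => /andP[bt ->].
by rewrite andbT (le_trans ab)// ltW.
Qed.

Lemma cintegrable_split a b c h : a <= b -> b <= c ->
  cintegrable a b h -> cintegrable b c h -> cintegrable a c h.
Proof. by move=> ab bc [? ?] [? ?]; split; apply: (integrable_itv_split ab bc). Qed.

Lemma cint_split a b c h : a <= b -> b <= c -> cintegrable a c h ->
  cint a c h = cint a b h + cint b c h.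
Proof.
move=> ab bc [h1 h2].
by rewrite /cint !(Rintegral_itv_split ab bc)//; apply: eqc; rewrite ?ReD ?ImD.
Qed.

(* The factor 2 comes from bounding the real and imaginary parts separately;
   all uses are insensitive to it. *)
Lemma normc_cint a b h (k : R -> R) : cintegrable a b h ->
  mu.-integrable `[a, b] (EFin \o k) ->
  (forall t, t \in `[a, b] -> normc (h t) <= k t) ->
  normc (cint a b h) <= 2 * \int[mu]_(t in `[a, b]) k t.
Proof.
move=> [h1 h2] ki hk; rewrite (le_trans (normc_le_ReIm _))//= mulrDl !mul1r.
apply: lerD.
  apply: le_trans (le_normr_Rintegral _ h1) _ => //.
  apply: le_Rintegral => //; first exact: (integrable_norm h1).
  by move=> t /= tab; rewrite (le_trans (Re_le_normc _))// hk.
apply: le_trans (le_normr_Rintegral _ h2) _ => //.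
apply: le_Rintegral => //; first exact: (integrable_norm h2).
by move=> t /= tab; rewrite (le_trans (Im_le_normc _))// hk.
Qed.

Lemma normc_cint_cst a b h (M : R) : a <= b -> cintegrable a b h ->
  (forall t, t \in `[a, b] -> normc (h t) <= M) ->
  normc (cint a b h) <= 2 * M * (b - a).
Proof.
move=> ab hi hM; apply: le_trans (normc_cint (k := fun=> M) hi _ hM) _.
  by apply: (continuous_compact_integrable (@segment_compact R a b)) => x; exact: cvg_cst.
rewrite Rintegral_cst//= lebesgue_measure_itv/= lte_fin.
rewrite -mulrA; move: ab; rewrite le_eqVlt => /predU1P[->|ab].
  by rewrite ltxx subrr.
by rewrite ab.
Qed.

Lemma ccont_integrable a b h : ccont `[a, b] h -> cintegrable a b h.
Proof.
by move=> [h1 h2]; split; apply: continuous_compact_integrable => //;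
  exact: segment_compact.
Qed.

Lemma ccont_bounded a b h : a <= b -> ccont `[a, b] h ->
  exists2 M : R, 0 <= M & forall t, t \in `[a, b] -> normc (h t) <= M.
Proof.
move=> ab [h1 h2].
have [c1 _ M1] := EVT_max ab (fun x => continuous_comp (h1 x) (@norm_continuous _ _ _)).
have [c2 _ M2] := EVT_max ab (fun x => continuous_comp (h2 x) (@norm_continuous _ _ _)).
exists (`|Re (h c1)| + `|Im (h c2)|); first by rewrite addr_ge0.
move=> t tab; rewrite (le_trans (normc_le_ReIm _))// lerD//; first exact: (M1 t).
exact: (M2 t).
Qed.

Lemma ccont_sub (A B : set R) h : A `<=` B -> ccont B h -> ccont A h.
Proof. by move=> AB [? ?]; split; apply: (continuous_subspaceW AB). Qed.

Lemma eq_ccont (A : set R) h k : {in A, h =1 k} -> ccont A h -> ccont A k.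
Proof.
move=> hk [h1 h2]; split.
  by apply: subspace_eq_continuous h1 => t /hk E /=; rewrite /from_subspace/= E.
by apply: subspace_eq_continuous h2 => t /hk E /=; rewrite /from_subspace/= E.
Qed.

Lemma ccont_cst (A : set R) z : ccont A (fun=> z).
Proof. by split=> x; exact: cvg_cst. Qed.

Lemma ccontD (A : set R) h k : ccont A h -> ccont A k -> ccont A (fun t => h t + k t).
Proof.
move=> [h1 h2] [k1 k2]; split=> x.
  under eq_fun do rewrite ReD; apply: cvgD; [exact: h1|exact: k1].
under eq_fun do rewrite ImD; apply: cvgD; [exact: h2|exact: k2].
Qed.

Lemma ccontM (A : set R) h k : ccont A h -> ccont A k -> ccont A (fun t => h t * k t).
Proof.
move=> [h1 h2] [k1 k2]; split=> x.
  under eq_fun do rewrite ReM; apply: cvgB; apply: cvgM;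
    by [exact: h1|exact: k1|exact: h2|exact: k2].
under eq_fun do rewrite ImM; apply: cvgD; apply: cvgM;
  by [exact: h1|exact: k1|exact: h2|exact: k2].
Qed.

Lemma ccontB (A : set R) h k : ccont A h -> ccont A k -> ccont A (fun t => h t - k t).
Proof.
move=> hc kc; apply: (@eq_ccont A (fun t => h t + (-1) * k t)).
  by move=> t _; rewrite mulN1r.
by apply: ccontD => //; apply: ccontM => //; exact: ccont_cst.
Qed.

Lemma ccontX (A : set R) h n : ccont A h -> ccont A (fun t => h t ^+ n).
Proof.
move=> hc; elim: n => [|n ih]; first exact: ccont_cst.
apply: (@eq_ccont A (fun t => h t * h t ^+ n)); last exact: ccontM.
by move=> t _; rewrite exprS.
Qed.

(* Junk values of the inverse off [A] are harmless: the continuity is the one of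
   the subspace [A]. *)
Lemma ccontV (A : set R) h : (forall t, A t -> h t != 0) -> ccont A h ->
  ccont A (fun t => (h t)^-1).
Proof.
move=> h0 [h1 h2].
have N x : A x -> Re (h x) ^+ 2 + Im (h x) ^+ 2 != 0.
  by move=> /h0; rewrite -normc_sqr sqrf_eq0 normc_eq0.
have D : forall x, A x -> (fun t => Re (h t) ^+ 2 + Im (h t) ^+ 2) @ within A (nbhs x) -->
    Re (h x) ^+ 2 + Im (h x) ^+ 2.
  move=> x Ax; move/subspace_continuousP : h1 => /(_ x Ax) h1.
  move/subspace_continuousP : h2 => /(_ x Ax) h2.
  by apply: cvgD; apply: cvgM.
split; apply/subspace_continuousP => x Ax.
  under eq_fun do rewrite ReV.
  apply: cvgM; first by move/subspace_continuousP : h1 => /(_ x Ax).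
  by apply: cvgV; [exact: N|exact: D].
under eq_fun do rewrite ImV.
apply: cvgN; apply: cvgM; first by move/subspace_continuousP : h2 => /(_ x Ax).
by apply: cvgV; [exact: N|exact: D].
Qed.

Lemma cintegrableM a b h k : a <= b -> ccont `[a, b] h -> cintegrable a b k ->
  cintegrable a b (fun t => h t * k t).
Proof.
move=> ab hc [k1 k2]; have [h1 h2] := hc; have [M M0 hM] := ccont_bounded ab hc.
have [/integrableP[/measurable_EFinP mh1 _] /integrableP[/measurable_EFinP mh2 _]] :=
  ccont_integrable hc.
have bh1 : [bounded Re (h t) | t in `[a, b]].
  exists M; split; rewrite ?num_real// => x /ltW Mx t /= tab.
  by rewrite (le_trans (Re_le_normc _))// (le_trans (hM _ _)).
have bh2 : [bounded Im (h t) | t in `[a, b]].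
  exists M; split; rewrite ?num_real// => x /ltW Mx t /= tab.
  by rewrite (le_trans (Im_le_normc _))// (le_trans (hM _ _)).
have mab : measurable (`[a, b]%classic : set (measurableTypeR R)) by [].
split.
  have := integrableB mab (integrableMr mab mh1 bh1 k1) (integrableMr mab mh2 bh2 k2).
  by apply: eq_integrable => // t _; rewrite /= ReM.
have := integrableD mab (integrableMr mab mh1 bh1 k2) (integrableMr mab mh2 bh2 k1).
by apply: eq_integrable => // t _; rewrite /= ImM.
Qed.

End SegmentIntegral.

(** * Continuity and complex derivatives in epsilon-delta form *)

Section ComplexContinuity.
Context {R : realType}.
Implicit Types (f F : R[i] -> R[i]) (p z w : R[i]) (h : R -> R[i]).

(** The norm of [R[i]] as a normed module takes its values in [R[i]]. These forms use the
    real-valued [normc], so that they combine directly with real estimates. *)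
Definition ccontinuous_at f p := forall e : R, 0 < e ->
  exists2 d : R, 0 < d & forall w, normc (w - p) < d -> normc (f w - f p) < e.

Definition cderivable_at f p (l : R[i]) := forall e : R, 0 < e ->
  exists2 d : R, 0 < d & forall w, normc (w - p) < d ->
    normc (f w - f p - l * (w - p)) <= e * normc (w - p).

Lemma cderivable_ccontinuous f p l : cderivable_at f p l -> ccontinuous_at f p.
Proof.
move=> fl e e0; have [d d0 fd] := fl 1 ltr01.
have K0 : 0 < 1 + normc l by rewrite ltr_pwDl// normc_ge0.
exists (Num.min d (e / (1 + normc l))); first by rewrite lt_min d0 divr_gt0.
move=> w; rewrite lt_min => /andP[wd we].
have -> : f w - f p = (f w - f p - l * (w - p)) + l * (w - p) by rewrite subrK.
rewrite (le_lt_trans (normcD _ _))// Normc.normcM.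
apply: (@le_lt_trans _ _ ((1 + normc l) * normc (w - p))).
  by rewrite mulrDl lerD2r; exact: fd.
by rewrite mulrC -ltr_pdivlMr.
Qed.

Lemma derivable_cderivable f p :
  derivable (f : R[i]^o -> R[i]^o) p 1 -> exists l, cderivable_at f p l.
Proof.
move=> /cvg_ex[/= l fl]; exists l => e e0.
have e0' : 0 < (e%:C : R[i]) by rewrite ltcR.
move/cvgrPdist_lt : fl => /(_ _ e0')/nbhs_ballP[d /= d0 fd].
(* The radius supplied by the filter is a positive element of [R[i]], hence real. *)
have [r rd] : exists r, d = r%:C.
  by exists (Re d); rewrite RRe_real// gtr0_real.
subst d; rewrite ltcR in d0.
exists r => // w wp; have [->|wp0] := eqVneq w p.
  by rewrite !subrr mulr0 subrr Normc.normc0 mulr0.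
have wp1 : w - p != 0 by rewrite subr_eq0.
have /= := fd (w - p); rewrite -ball_normE /= sub0r normrN.
have E z : `|z| = (normc z)%:C by case: z.
rewrite E ltcR wp => /(_ isT wp1).
rewrite /GRing.scale /= mulr1 subrK E ltcR => H.
have -> : f w - f p - l * (w - p) = - ((l - (w - p)^-1 * (f w - f p)) * (w - p)).
  by rewrite mulrBl mulrAC mulVf// mul1r; ring.
by rewrite normcN Normc.normcM ler_wpM2r ?normc_ge0// ltW.
Qed.

Lemma ccont_comp (A : set R) h f : ccont A h ->
  (forall t, A t -> ccontinuous_at f (h t)) -> ccont A (fun t => f (h t)).
Proof.
move=> [/subspace_continuousP h1 /subspace_continuousP h2] fc.
have H t : A t -> forall e : R, 0 < e ->
    \forall s \near within A (nbhs t), normc (f (h t) - f (h s)) < e.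
  move=> At e e0; have [d d0 fd] := fc _ At _ e0.
  have d20 : 0 < d / 2 by rewrite divr_gt0.
  have /cvgrPdist_lt/(_ _ d20) n1 := h1 _ At.
  have /cvgrPdist_lt/(_ _ d20) n2 := h2 _ At.
  near=> s; rewrite normcB; apply: fd; rewrite normcB.
  rewrite (le_lt_trans (normc_le_ReIm _))// ReB ImB [ltRHS]splitr.
  by apply: ltrD; near: s.
by split; apply/subspace_continuousP => t At; apply/cvgrPdist_lt => e e0;
  near=> s; rewrite /= -?ReB -?ImB;
  (apply: le_lt_trans; [exact: Re_le_normc || exact: Im_le_normc|]);
  near: s; exact: H.
Unshelve. all: by end_near. Qed.

End ComplexContinuity.

(** * Calculus of complex-valued functions of a real variable *)

Section FundamentalTheorem.
Context {R : realType}.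
Implicit Types (a b t : R) (h k u : R -> R[i]) (z d : R[i]) (F : R[i] -> R[i]).
Local Notation mu := (@lebesgue_measure R).

(** Endpoints have measure zero. This matters because at a break point of a piecewise C1 curve
    [derive1], and with it [curve_deriv], need not be the one-sided limit of the derivative. *)
Lemma integrable_eq_oo a b (f g : R -> R) : {in `]a, b[, f =1 g} ->
  mu.-integrable `[a, b] (EFin \o f) -> mu.-integrable `[a, b] (EFin \o g).
Proof.
move=> fg fi.
have fi' : mu.-integrable `]a, b[ (EFin \o f).
  by apply: integrableS fi => // t /=; rewrite !in_itv/= => /andP[/ltW -> /ltW ->].
have gi' : mu.-integrable `]a, b[ (EFin \o g).
  by apply: eq_integrable fi' => // t /set_mem /= tab; rewrite /= fg.
have /integrableP[mg ig] := gi'.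
have mg' : measurable_fun `[a, b] g.
  by apply: (@measurable_fun_itv_cc R a b false true); exact/measurable_EFinP.
apply/integrableP; split; first exact/measurable_EFinP.
rewrite integral_itv_bndoo//.
by have /integrableP[] := integrable_abse gi'.
Qed.

Lemma Rintegral_eq_oo a b (f g : R -> R) : {in `]a, b[, f =1 g} ->
  mu.-integrable `[a, b] (EFin \o f) ->
  \int[mu]_(t in `[a, b]) f t = \int[mu]_(t in `[a, b]) g t.
Proof.
move=> fg fi; have gi := integrable_eq_oo fg fi.
have S (k : R -> R) : mu.-integrable `[a, b] (EFin \o k) ->
    \int[mu]_(t in `[a, b]) k t = \int[mu]_(t in `]a, b[) k t.
  move=> ki; rewrite /Rintegral integral_itv_bndoo//.
  have : mu.-integrable `]a, b[ (EFin \o k).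
    by apply: integrableS ki => // t /=; rewrite !in_itv/= => /andP[/ltW -> /ltW ->].
  by case/integrableP.
rewrite !S//; apply: eq_Rintegral => t /set_mem /= tab; exact: fg.
Qed.

Lemma cintegrable_eq_oo a b h k : {in `]a, b[, h =1 k} ->
  cintegrable a b h -> cintegrable a b k.
Proof.
by move=> hk [h1 h2]; split; [apply: integrable_eq_oo h1|apply: integrable_eq_oo h2]
  => t /hk ->.
Qed.

Lemma cint_eq_oo a b h k : {in `]a, b[, h =1 k} ->
  cintegrable a b h -> cint a b h = cint a b k.
Proof.
by move=> hk [h1 h2]; congr (_ +i* _); apply: Rintegral_eq_oo => // t /hk ->.
Qed.

Definition cderive_is u t d := 
  is_derive t 1 (fun s => Re (u s)) (Re d) /\ is_derive t 1 (fun s => Im (u s)) (Im d).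

Lemma cderive_eq u t d d' : cderive_is u t d -> d = d' -> cderive_is u t d'.
Proof. by move=> ? <-. Qed.

Lemma cint_FTC a b u h : a < b -> ccont `[a, b] u -> ccont `[a, b] h ->
  {in `]a, b[, forall t, cderive_is u t (h t)} -> cint a b h = u b - u a.
Proof.
move=> ab [u1 u2] [h1 h2] uh.
have G (v k : R -> R) : {within `[a, b], continuous v} -> {within `[a, b], continuous k} ->
    {in `]a, b[, forall t, is_derive t 1 v (k t)} ->
    \int[mu]_(t in `[a, b]) k t = v b - v a.
  move=> cv ck vk; rewrite /Rintegral (continuous_FTC2 ab ck (F := v))//.
    have [_ ? ?] := (continuous_within_itvP v ab).1 cv.
    by split=> // t /vk H; exact: ex_derive.
  by move=> t /vk H; rewrite derive1E; exact: derive_val.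
rewrite /cint (G (fun t => Re (u t)))// ?(G (fun t => Im (u t)))//.
- by apply: eqc; rewrite ?ReB ?ImB.
- by move=> t /uh[].
- by move=> t /uh[].
Qed.

Lemma cderive_cst t z : cderive_is (fun=> z) t 0.
Proof. by split; apply: is_derive_cst. Qed.

Lemma cderiveD u k t d d' : cderive_is u t d -> cderive_is k t d' ->
  cderive_is (fun s => u s + k s) t (d + d').
Proof.
move=> [u1 u2] [k1 k2]; split.
  rewrite ReD (_ : (fun s => _) = (fun s => Re (u s)) + (fun s => Re (k s))).
    exact: is_deriveD.
  by apply/funext => s; rewrite ReD.
rewrite ImD (_ : (fun s => _) = (fun s => Im (u s)) + (fun s => Im (k s))).
  exact: is_deriveD.
by apply/funext => s; rewrite ImD.
Qed.

Lemma cderiveM u k t d d' : cderive_is u t d -> cderive_is k t d' ->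
  cderive_is (fun s => u s * k s) t (u t * d' + k t * d).
Proof.
move=> [u1 u2] [k1 k2]; split.
  rewrite (_ : (fun s => _) = (fun s => Re (u s)) * (fun s => Re (k s)) -
    (fun s => Im (u s)) * (fun s => Im (k s))).
    apply: is_derive_eq (is_deriveB (is_deriveM u1 k1) (is_deriveM u2 k2)) _.
    by rewrite /GRing.scale /= !ReImE; ring.
  by apply/funext => s; rewrite ReM.
rewrite (_ : (fun s => _) = (fun s => Re (u s)) * (fun s => Im (k s)) +
    (fun s => Im (u s)) * (fun s => Re (k s))).
  apply: is_derive_eq (is_deriveD (is_deriveM u1 k2) (is_deriveM u2 k1)) _.
  by rewrite /GRing.scale /= !ReImE; ring.
by apply/funext => s; rewrite ImM.
Qed.

Lemma cderiveV u t d : u t != 0 -> cderive_is u t d ->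
  cderive_is (fun s => (u s)^-1) t (- d / u t ^+ 2).
Proof.
move=> ut0 [u1 u2].
pose n s := Re (u s) ^+ 2 + Im (u s) ^+ 2.
have n0 : n t != 0 by rewrite /n -normc_sqr sqrf_eq0 normc_eq0.
have dn : is_derive t (1 : R) n (2 * (Re (u t) * Re d + Im (u t) * Im d)).
  rewrite (_ : n = (fun s => Re (u s)) * (fun s => Re (u s)) +
    (fun s => Im (u s)) * (fun s => Im (u s))).
    apply: is_derive_eq (is_deriveD (is_deriveM u1 u1) (is_deriveM u2 u2)) _.
    by rewrite /GRing.scale /=; ring.
  by apply/funext.
have dnV := is_deriveV n0 dn.
have n0' : Re (u t) ^+ 2 + Im (u t) ^+ 2 != 0 := n0.
have sq : Re (u t ^+ 2) ^+ 2 + Im (u t ^+ 2) ^+ 2 = n t ^+ 2.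
  by rewrite expr2 !ReImE /n; ring.
split.
  rewrite (_ : (fun s => _) = (fun s => Re (u s)) * (fun s => (n s)^-1)).
    apply: is_derive_eq (is_deriveM u1 dnV) _.
    rewrite /GRing.scale /= ReM ReV ImV sq !ReImE /n !expr2 /=.
    by field.
  by apply/funext => s; rewrite ReV.
rewrite (_ : (fun s => _) = - ((fun s => Im (u s)) * (fun s => (n s)^-1))).
  apply: is_derive_eq (is_deriveN (is_deriveM u2 dnV)) _.
  rewrite /GRing.scale /= ImM ReV ImV sq !ReImE /n !expr2 /=.
  by field.
by apply/funext => s; rewrite ImV.
Qed.

Lemma cderiveX u t d n : cderive_is u t d ->
  cderive_is (fun s => u s ^+ n) t (n%:R * u t ^+ n.-1 * d).
Proof.
move=> ud; elim: n => [|n ih].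
  by apply: cderive_eq (cderive_cst t 1) _; rewrite !mul0r.
rewrite (_ : (fun s => _) = (fun s => u s * u s ^+ n)); last first.
  by apply/funext => s; rewrite exprS.
apply: cderive_eq (cderiveM ud ih) _.
case: n {ih} => [|n] /=; first by rewrite !expr0; ring.
by rewrite [n.+2%:R]mulrSr exprS; ring.
Qed.

End FundamentalTheorem.

(** * Contour integrals *)

Section PrimitivePairs.
Context {R : realType}.
Implicit Types (D : set R[i]) (F f : R[i] -> R[i]) (u : R -> R[i]) (b z : R[i]).

(* Only the chain rule along curves is recorded, so that primitives such as powers
   need no complex differentiability argument. *)
Definition cprimitive D F f :=
  (forall u t d, cderive_is u t d -> D (u t) ->
     cderive_is (fun s => F (u s)) t (f (u t) * d)) /\
  (forall (A : set R) u, ccont A u -> (forall t, A t -> D (u t)) ->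
     ccont A (fun t => F (u t)) /\ ccont A (fun t => f (u t))).

Lemma cderiveB_cst u t (d b : R[i]) : cderive_is u t d -> cderive_is (fun s => u s - b) t d.
Proof.
by move=> ud; apply: cderive_eq (cderiveD ud (cderive_cst t (- b))) _; rewrite addr0.
Qed.

Lemma cprimitiveX b n :
  cprimitive setT (fun z => n.+1%:R^-1 * (z - b) ^+ n.+1) (fun z => (z - b) ^+ n).
Proof.
split=> [u t d ud _|A u uc _].
  apply: cderive_eq (cderiveM (cderive_cst t _) (cderiveX n.+1 (cderiveB_cst b ud))) _.
  by rewrite /= mulr0 addr0 !mulrA mulVf ?pnatr_eq0// mul1r.
have c : ccont A (fun t => u t - b) by apply: ccontB => //; exact: ccont_cst.
by split; [apply: ccontM; [exact: ccont_cst|]|]; exact: ccontX.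
Qed.

(** The exponents start at 2: the inverse itself has no primitive on the punctured plane, and it is
    there that winding numbers enter. *)
Lemma cprimitiveXV b n :
  cprimitive [set z | z != b] (fun z => - n.+1%:R^-1 * ((z - b)^-1) ^+ n.+1)
    (fun z => ((z - b)^-1) ^+ n.+2).
Proof.
split=> [u t d ud /= ub|A u uc ub].
  have ub' : u t - b != 0 by rewrite subr_eq0.
  apply: cderive_eq (cderiveM (cderive_cst t _)
    (cderiveX n.+1 (cderiveV ub' (cderiveB_cst b ud)))) _.
  rewrite /= mulr0 addr0 expr2 invfM; set i := (u t - b)^-1.
  by rewrite !mulrA mulNr mulVf ?pnatr_eq0// !exprS; ring.
have c : ccont A (fun t => (u t - b)^-1).
  apply: ccontV => [t /ub /=|]; first by rewrite subr_eq0.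
  by apply: ccontB => //; exact: ccont_cst.
by split; [apply: ccontM; [exact: ccont_cst|]|]; exact: ccontX.
Qed.

End PrimitivePairs.

(** * Piecewise C1 curves and the primitive formula *)

Section Contour.
Context {R : realType}.
Implicit Types (a b t : R) (u gamma : R -> R[i]) (F f g : R[i] -> R[i]) (D : set R[i]).
Local Notation mu := (@lebesgue_measure R).

(** Confines the handling of partition lists to one place: a property stable under concatenation has
    only to be checked on C1 pieces. *)
Lemma piecewise_C1_ind gamma (Q : R -> R -> Prop) :
  (forall a b, a < b -> C1_on_segment a b (fun s => Re (gamma s)) ->
     C1_on_segment a b (fun s => Im (gamma s)) -> Q a b) ->
  (forall a b c, a < b -> b < c -> Q a b -> Q b c -> Q a c) ->
  piecewise_C1 gamma -> Q 0 1.
Proof.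
move=> Q1 Q2 [ts [pts lts] Hts].
have ts0 : ts != [::] by case: ts lts {pts Hts} => //= /eqP /esym/eqP; rewrite oner_eq0.
(* The left end is generalized from 0 to [a], since the induction strips pieces from the left. *)
suff H : forall ts a, ts != [::] -> path <%O a ts -> last a ts == 1 ->
    (forall k, (k < size ts)%N ->
      C1_on_segment (nth 0 (a :: ts) k) (nth 0 ts k) (fun s => Re (gamma s)) /\
      C1_on_segment (nth 0 (a :: ts) k) (nth 0 ts k) (fun s => Im (gamma s))) -> Q a 1.
  exact: H Hts.
move=> {pts lts Hts ts0} {}ts a; case: ts => // x ts _.
elim: ts x a => [|y ts ih] x a /= /andP[ax pts] /eqP lts Hts.
  by rewrite -lts; have [] := Hts 0%N isT; exact: Q1.
have y1 : y <= 1.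
  move: pts; rewrite -lts => /andP[_]; elim: (ts) y {ih Hts lts} => //= z s ih y /andP[yz /ih].
  by apply: le_trans; exact: ltW.
have xy : x < y by case/andP : pts.
apply: (Q2 _ x) => //; first exact: lt_le_trans y1.
  by have [] := Hts 0%N isT; exact: Q1.
apply: (ih y) => //=; last by move=> k kts; exact: (Hts k.+1 kts).
by rewrite lts.
Qed.

(** The property fed to [piecewise_C1_ind]. Continuity and integrability accompany the primitive
    formula because cutting the integral at a break point requires them. *)
Definition contour_good gamma a b :=
  [/\ ccont `[a, b] gamma, cintegrable a b (curve_deriv gamma) &
    forall D F f, cprimitive D F f -> (forall t, t \in `[a, b] -> D (gamma t)) ->
      cint a b (fun t => f (gamma t) * curve_deriv gamma t) = F (gamma b) - F (gamma a)].

Lemma contour_good_C1 gamma a b : a < b ->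
  C1_on_segment a b (fun s => Re (gamma s)) ->
  C1_on_segment a b (fun s => Im (gamma s)) -> contour_good gamma a b.
Proof.
move=> ab [c1 [v1 cv1 d1]] [c2 [v2 cv2 d2]].
have cg : ccont `[a, b] gamma.
  by split; exact: derivable_oo_LRcontinuous_within.
pose v t := v1 t +i* v2 t.
have cv : ccont `[a, b] v by [].
have vE : {in `]a, b[, v =1 curve_deriv gamma}.
  by move=> t tab; rewrite /v /curve_deriv d1// d2.
have vi : cintegrable a b v := ccont_integrable cv.
split=> //; first exact: cintegrable_eq_oo vE vi.
move=> D F f [FD Fc] gD; have [cF cf] := Fc _ _ cg gD.
have cfv : ccont `[a, b] (fun t => f (gamma t) * v t) by exact: ccontM.
rewrite -(@cint_eq_oo _ _ _ (fun t => f (gamma t) * v t)); last 2 first.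
- by move=> t /vE ->.
- exact: ccont_integrable.
apply: (cint_FTC (u := fun t => F (gamma t))) => // t tab.
apply: FD; last by apply: gD; exact: subset_itv_oo_cc.
have [/(_ _ tab) e1 _ _] := c1; have [/(_ _ tab) e2 _ _] := c2.
by split; [have := derivableP e1; rewrite -derive1E d1|
  have := derivableP e2; rewrite -derive1E d2].
Qed.

Lemma contour_good_cat gamma a b c : a < b -> b < c ->
  contour_good gamma a b -> contour_good gamma b c -> contour_good gamma a c.
Proof.
move=> ab bc [c1 i1 f1] [c2 i2 f2].
have E : `[a, c]%classic = `[a, b]%classic `|` `[b, c]%classic.
  apply/seteqP; split => [t|t [|]] /=; rewrite !in_itv/=.
  - by move=> /andP[at' tc]; case: (leP t b) => tb; [left|right];
      rewrite ?at' ?tc ?(ltW tb).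
  - by move=> /andP[-> /le_trans ->]//; exact: ltW.
  - by move=> /andP[/(le_trans (ltW ab)) -> ->].
have cg : ccont `[a, c] gamma.
  have [? ?] := c1; have [? ?] := c2.
  by split; rewrite E; apply: withinU_continuous => //; exact: interval_closed.
have ig : cintegrable a c (curve_deriv gamma).
  exact: cintegrable_split (ltW ab) (ltW bc) i1 i2.
split=> // D F f Ff gD; have [_ Fc] := Ff.
have [_ cf] := Fc _ _ cg gD.
rewrite (cint_split (ltW ab) (ltW bc)); last first.
  by apply: cintegrableM => //; apply: ltW; exact: lt_trans bc.
rewrite (f1 D F)//; last first.
  move=> t; rewrite in_itv/= => /andP[? tb].
  by apply: gD; rewrite in_itv/=; apply/andP; split=> //; exact: le_trans (ltW bc).
rewrite (f2 D F)//; first by ring.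
move=> t; rewrite in_itv/= => /andP[? tb].
by apply: gD; rewrite in_itv/=; apply/andP; split=> //; exact: le_trans (ltW ab) _.
Qed.

Lemma contour_goodP gamma : piecewise_C1 gamma -> contour_good gamma 0 1.
Proof.
apply: piecewise_C1_ind => [a b|a b c ab bc H1 H2]; first exact: contour_good_C1.
exact: contour_good_cat ab bc H1 H2.
Qed.

End Contour.

(** * Integrals along a closed contour *)

Section ContourIntegral.
Context {R : realType}.
Variable gamma : R -> R[i].
Hypothesis gammaC1 : piecewise_C1 gamma.
Hypothesis gamma_closed : gamma 0 = gamma 1.
Implicit Types (F f g : R[i] -> R[i]) (D : set R[i]) (z : R[i]).
Local Notation mu := (@lebesgue_measure R).
Local Notation ointegral := (contour_integral gamma).

Definition con_curve g := ccont `[0, 1] (fun t => g (gamma t)).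

Lemma con_curve_id : con_curve id.
Proof. by have [] := contour_goodP gammaC1. Qed.

Lemma con_curve_integrable g : con_curve g ->
  cintegrable 0 1 (fun t => g (gamma t) * curve_deriv gamma t).
Proof. by move=> gc; apply: cintegrableM => //; have [] := contour_goodP gammaC1. Qed.

Lemma eq_contour f g : (forall t, t \in `[0, 1] -> f (gamma t) = g (gamma t)) ->
  ointegral f = ointegral g.
Proof. by move=> fg; apply: (@eq_cint _ 0 1) => t /fg ->. Qed.

Lemma contourZ z f : con_curve f -> ointegral (fun w => z * f w) = z * ointegral f.
Proof.
move=> fc; rewrite -[RHS](cintZ z (con_curve_integrable fc)).
by apply: eq_cint => t _; rewrite mulrA.
Qed.

Lemma contourB f g : con_curve f -> con_curve g ->
  ointegral (fun z => f z - g z) = ointegral f - ointegral g.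
Proof.
move=> fc gc; rewrite -[RHS](cintB (con_curve_integrable fc) (con_curve_integrable gc)).
by apply: eq_cint => t _; rewrite mulrBl.
Qed.

Lemma contour_sum n (c : nat -> R[i]) (F : nat -> R[i] -> R[i]) :
  (forall i, con_curve (F i)) ->
  ointegral (fun z => \sum_(i < n) c i * F i z) = \sum_(i < n) c i * ointegral (F i).
Proof.
move=> Fc.
pose G i t := c i * (F i (gamma t) * curve_deriv gamma t).
transitivity (cint 0 1 (fun t => \sum_(i < n) G i t)).
  by apply: eq_cint => t _; rewrite mulr_suml; apply: eq_bigr => i _; rewrite /G mulrA.
rewrite cint_sum; last by move=> i _; apply: cintegrableZ; exact: con_curve_integrable.
by apply: eq_bigr => i _; rewrite /G cintZ//; exact: con_curve_integrable.
Qed.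

Lemma contour_primitive D F f : cprimitive D F f ->
  (forall t, t \in `[0, 1] -> D (gamma t)) -> ointegral f = 0.
Proof.
move=> Ff gD; have [_ _ /(_ _ _ _ Ff gD)] := contour_goodP gammaC1.
by rewrite gamma_closed subrr.
Qed.

Lemma con_curveX z n : con_curve (fun w => (w - z) ^+ n).
Proof. by apply: ccontX; apply: ccontB; [exact: con_curve_id|exact: ccont_cst]. Qed.

Lemma contour_poly (p : {poly R[i]}) : ointegral (fun w => p.[w]) = 0.
Proof.
transitivity (ointegral (fun w => \sum_(i < size p) p`_i * (w - 0) ^+ i)).
  by apply: eq_contour => t _; rewrite subr0 horner_coef.
rewrite (contour_sum (size p) (fun i => p`_i) (F := fun i w => (w - 0) ^+ i)); last first.
  by move=> i; exact: con_curveX.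
by rewrite big1// => i _; rewrite (contour_primitive (cprimitiveX 0 i))// mulr0.
Qed.

(** [L] plays the role of the length of the curve. It does not depend on [g], so uniform convergence
    on the curve passes to the integrals. *)
Lemma contour_bound : exists2 L : R, 0 <= L &
  forall g (M : R), 0 <= M -> con_curve g ->
    (forall t, t \in `[0, 1] -> normc (g (gamma t)) <= M) ->
    normc (ointegral g) <= L * M.
Proof.
have [_ [i1 i2] _] := contour_goodP gammaC1.
pose k t := `|Re (curve_deriv gamma t)| + `|Im (curve_deriv gamma t)|.
have ki : mu.-integrable `[0, 1] (EFin \o k).
  apply: eq_integrable (integrableD _ (integrable_norm i1) (integrable_norm i2)) => //.
exists (2 * \int[mu]_(t in `[0, 1]) k t).
  by rewrite mulr_ge0// Rintegral_ge0// => t _; rewrite addr_ge0.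
move=> g M M0 gc gM.
have kMi : mu.-integrable `[0, 1] (EFin \o (fun t => M * k t)).
  by apply: eq_integrable (integrableZl _ M ki).
rewrite mulrAC -mulrA -RintegralZl//.
apply: normc_cint kMi _; first exact: con_curve_integrable.
move=> t t01; rewrite Normc.normcM ler_pM ?normc_ge0 ?gM//.
exact: normc_le_ReIm.
Qed.

End ContourIntegral.

(** * Goursat's theorem and power series expansions *)

Section RectangleIntegral.
Context {R : realType}.
Implicit Types (a b c d t x y : R) (F f g : R[i] -> R[i]) (D : set R[i]) (z w p : R[i]).

(** The counterclockwise boundary integral: bottom minus top edge, then right minus left edge, where
    dz is ['i] times dy. *)
Definition rect_integral f a b c d : R[i] :=
  (cint a b (fun x => f (x +i* c)) - cint a b (fun x => f (x +i* d))) +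
  'i * (cint c d (fun y => f (b +i* y)) - cint c d (fun y => f (a +i* y))).

Definition rectangle a b c d : set R[i] :=
  [set z | a <= Re z <= b /\ c <= Im z <= d].

Definition con_edges f a b c d :=
  (ccont `[a, b] (fun x => f (x +i* c)) /\ ccont `[a, b] (fun x => f (x +i* d))) /\
  (ccont `[c, d] (fun y => f (b +i* y)) /\ ccont `[c, d] (fun y => f (a +i* y))).

Definition edges a b c d : set R[i] :=
  [set z | (a <= Re z <= b /\ (Im z = c \/ Im z = d)) \/
           (c <= Im z <= d /\ (Re z = a \/ Re z = b))].

Lemma edges_rectangle a b c d : a <= b -> c <= d -> edges a b c d `<=` rectangle a b c d.
Proof.
by move=> ab cd z; rewrite /edges /rectangle /=; case=> [[-> [->|->]]|[-> [->|->]]];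
  rewrite ?lexx ?ab ?cd.
Qed.

Lemma rectangle_sub a b c d a' b' c' d' : a <= a' -> b' <= b -> c <= c' -> d' <= d ->
  rectangle a' b' c' d' `<=` rectangle a b c d.
Proof.
move=> aa bb cc dd z [/andP[z1 z2] /andP[z3 z4]].
by split; rewrite ?(le_trans aa) ?(le_trans z2) ?(le_trans cc) ?(le_trans z4).
Qed.

Lemma ccont_horizontal (A : set R) y : ccont A (fun x => x +i* y).
Proof.
by split; apply: continuous_subspaceT => x; [exact: cvg_id|exact: cvg_cst].
Qed.

Lemma ccont_vertical (A : set R) x : ccont A (fun y => x +i* y).
Proof.
by split; apply: continuous_subspaceT => y; [exact: cvg_cst|exact: cvg_id].
Qed.

Lemma ccont_edges f a b c d :
  (forall z, edges a b c d z -> ccontinuous_at f z) -> con_edges f a b c d.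
Proof.
move=> fc; split; split; apply: (ccont_comp (f := f));
  try exact: ccont_horizontal; try exact: ccont_vertical;
  move=> t /=; rewrite in_itv/= => tab; apply: fc; rewrite /edges/=;
  by [left; split=> //; left|left; split=> //; right|right; split=> //; left|
      right; split=> //; right].
Qed.

Lemma rect_integralD f g a b c d : con_edges f a b c d -> con_edges g a b c d ->
  rect_integral (fun z => f z + g z) a b c d =
  rect_integral f a b c d + rect_integral g a b c d.
Proof.
move=> [[f1 f2] [f3 f4]] [[g1 g2] [g3 g4]]; rewrite /rect_integral.
by rewrite !cintD; try exact: ccont_integrable; ring.
Qed.

Lemma rect_integralZ z f a b c d : con_edges f a b c d ->
  rect_integral (fun w => z * f w) a b c d = z * rect_integral f a b c d.
Proof.
move=> [[f1 f2] [f3 f4]]; rewrite /rect_integral.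
by rewrite !cintZ; try exact: ccont_integrable; ring.
Qed.

Lemma con_edgesD f g a b c d : con_edges f a b c d -> con_edges g a b c d ->
  con_edges (fun z => f z + g z) a b c d.
Proof.
move=> [[f1 f2] [f3 f4]] [[g1 g2] [g3 g4]].
by split; split; apply: (@ccontD R).
Qed.

Lemma con_edgesM f g a b c d : con_edges f a b c d -> con_edges g a b c d ->
  con_edges (fun z => f z * g z) a b c d.
Proof.
move=> [[f1 f2] [f3 f4]] [[g1 g2] [g3 g4]].
by split; split; apply: (@ccontM R).
Qed.

Lemma con_edges_cst z a b c d : con_edges (fun=> z) a b c d.
Proof. by split; split; apply: ccont_cst. Qed.

Lemma con_edges_id a b c d : con_edges id a b c d.
Proof.
split; split; by [exact: ccont_horizontal|exact: ccont_vertical].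
Qed.

Lemma eq_rect_integral f g a b c d : a <= b -> c <= d ->
  (forall z, edges a b c d z -> f z = g z) ->
  rect_integral f a b c d = rect_integral g a b c d.
Proof.
move=> ab cd fg; rewrite /rect_integral.
congr (_ - _ + 'i * (_ - _)); apply: eq_cint => t; rewrite in_itv /= => tab;
  apply: fg; rewrite /edges/=;
  by [left; split=> //; left|left; split=> //; right|right; split=> //; left|
      right; split=> //; right].
Qed.

Lemma normc_i : normc ('i : R[i]) = 1.
Proof. by rewrite /= expr0n /= expr1n add0r sqrtr1. Qed.

Lemma normc_rect_integral f a b c d (M : R) : a <= b -> c <= d -> con_edges f a b c d ->
  (forall z, edges a b c d z -> normc (f z) <= M) ->
  normc (rect_integral f a b c d) <= 4 * M * ((b - a) + (d - c)).
Proof.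
move=> ab cd [[f1 f2] [f3 f4]] fM.
have H1 : normc (cint a b (fun x => f (x +i* c))) <= 2 * M * (b - a).
  apply: normc_cint_cst => // [|t]; first exact: ccont_integrable.
  by rewrite in_itv/= => tab; apply: fM; left; split=> //; left.
have H2 : normc (cint a b (fun x => f (x +i* d))) <= 2 * M * (b - a).
  apply: normc_cint_cst => // [|t]; first exact: ccont_integrable.
  by rewrite in_itv/= => tab; apply: fM; left; split=> //; right.
have H3 : normc (cint c d (fun y => f (b +i* y))) <= 2 * M * (d - c).
  apply: normc_cint_cst => // [|t]; first exact: ccont_integrable.
  by rewrite in_itv/= => tab; apply: fM; right; split=> //; right.
have H4 : normc (cint c d (fun y => f (a +i* y))) <= 2 * M * (d - c).
  apply: normc_cint_cst => // [|t]; first exact: ccont_integrable.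
  by rewrite in_itv/= => tab; apply: fM; right; split=> //; left.
apply: le_trans (normcD _ _) _; rewrite Normc.normcM normc_i mul1r.
have := normcD (cint a b (fun x => f (x +i* c))) (- cint a b (fun x => f (x +i* d))).
have := normcD (cint c d (fun y => f (b +i* y))) (- cint c d (fun y => f (a +i* y))).
rewrite !normcN; lra.
Qed.

Lemma rect_split_re f a m b c d : a <= m -> m <= b ->
  ccont `[a, b] (fun x => f (x +i* c)) -> ccont `[a, b] (fun x => f (x +i* d)) ->
  rect_integral f a b c d = rect_integral f a m c d + rect_integral f m b c d.
Proof.
move=> am mb f1 f2; rewrite /rect_integral.
by rewrite !(cint_split am mb); try exact: ccont_integrable; ring.
Qed.

Lemma rect_split_im f a b c m d : c <= m -> m <= d ->
  ccont `[c, d] (fun y => f (a +i* y)) -> ccont `[c, d] (fun y => f (b +i* y)) ->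
  rect_integral f a b c d = rect_integral f a b c m + rect_integral f a b m d.
Proof.
move=> cm md f1 f2; rewrite /rect_integral.
by rewrite !(cint_split cm md); try exact: ccont_integrable; ring.
Qed.

(** Each edge contributes a difference of [F] at two corners, and these cancel around the
    boundary. *)
Lemma rect_primitive D F f a b c d : a < b -> c < d -> cprimitive D F f ->
  (forall z, edges a b c d z -> D z) -> rect_integral f a b c d = 0.
Proof.
move=> ab cd [FD Fc] eD.
have H y : y = c \/ y = d -> cint a b (fun x => f (x +i* y)) = F (b +i* y) - F (a +i* y).
  move=> ycd.
  have uD t : `[a, b]%classic t -> D (t +i* y).
    by rewrite /= in_itv/= => tab; apply: eD; left; split.
  have [cF cf] := Fc _ _ (ccont_horizontal `[a, b] y) uD.
  apply: (cint_FTC (u := fun x => F (x +i* y))) => // t tab.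
  rewrite -[f _]mulr1; apply: FD; last by apply: uD; exact: subset_itv_oo_cc.
  by split=> /=; [exact: is_derive_id|exact: is_derive_cst].
have V x : x = a \/ x = b ->
    'i * cint c d (fun y => f (x +i* y)) = F (x +i* d) - F (x +i* c).
  move=> xab.
  have uD t : `[c, d]%classic t -> D (x +i* t).
    by rewrite /= in_itv/= => tab; apply: eD; right; split.
  have [cF cf] := Fc _ _ (ccont_vertical `[c, d] x) uD.
  rewrite -cintZ; last exact: ccont_integrable.
  apply: (cint_FTC (u := fun y => F (x +i* y))) => // [|t tab].
    by apply: ccontM => //; exact: ccont_cst.
  rewrite mulrC; apply: FD; last by apply: uD; exact: subset_itv_oo_cc.
  by split=> /=; [exact: is_derive_cst|exact: is_derive_id].
rewrite /rect_integral mulrBr !H ?V; by [left|right|ring].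
Qed.

End RectangleIntegral.

(** * Goursat's theorem on rectangles *)

Section Goursat.
Context {R : realType}.
Implicit Types (a b c d t x y e : R) (f : R[i] -> R[i]) (z w p : R[i]).

Lemma rect_affine z w p a b c d : a < b -> c < d ->
  rect_integral (fun q => z + w * (q - p)) a b c d = 0.
Proof.
move=> ab cd.
have c1 : con_edges (fun q => q - p) a b c d.
  by apply: con_edgesD; [exact: con_edges_id|exact: con_edges_cst].
rewrite (rect_integralD (con_edges_cst z _ _ _ _)); last first.
  by apply: con_edgesM => //; exact: con_edges_cst.
rewrite rect_integralZ//.
have E1 : rect_integral (fun q => q - p) a b c d = 0.
  exact: (rect_primitive ab cd (cprimitiveX p 1) (fun _ _ => I)).
have E0 : rect_integral (fun=> 1) a b c d = 0.
  exact: (rect_primitive ab cd (cprimitiveX p 0) (fun _ _ => I)).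
have -> : rect_integral (fun=> z) a b c d = z * rect_integral (fun=> 1) a b c d.
  rewrite -rect_integralZ; last exact: con_edges_cst.
  by apply: eq_rect_integral => [||q _]; rewrite ?ltW// mulr1.
by rewrite E0 E1 !mulr0 addr0.
Qed.

Lemma nested_segments (u v : nat -> R) :
  (forall n, u n <= u n.+1) -> (forall n, v n.+1 <= v n) -> (forall n, u n <= v n) ->
  exists x, forall n, u n <= x <= v n.
Proof.
move=> uu vv uv.
have um n k : u n <= u (n + k)%N.
  by elim: k => [|k ih]; rewrite ?addn0// addnS (le_trans ih).
have vm n k : v (n + k)%N <= v n.
  by elim: k => [|k ih]; rewrite ?addn0// addnS (le_trans _ ih).
have uvnm n m : u n <= v m.
  rewrite (le_trans (um n m))// (le_trans (uv _))// addnC; exact: vm.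
exists (sup (range u)) => n; apply/andP; split.
  apply: ub_le_sup; last by exists n.
  by exists (v 0%N) => _ [m _ <-].
by apply: ge_sup; [exists (u 0%N), 0%N|move=> _ [m _ <-]].
Qed.

Lemma rect_quarters f a b c d : a < b -> c < d ->
  (forall z, rectangle a b c d z -> ccontinuous_at f z) ->
  let m := (a + b) / 2 in let n := (c + d) / 2 in
  rect_integral f a b c d =
    (rect_integral f a m c n + rect_integral f a m n d) +
    (rect_integral f m b c n + rect_integral f m b n d).
Proof.
move=> ab cd fc m n.
have am : a <= m by rewrite /m; lra.
have mb : m <= b by rewrite /m; lra.
have cn : c <= n by rewrite /n; lra.
have nd : n <= d by rewrite /n; lra.
have H y : c <= y <= d -> ccont `[a, b] (fun x => f (x +i* y)).
  move=> ycd; apply: (ccont_comp (f := f)); first exact: ccont_horizontal.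
  by move=> t; rewrite /= in_itv/= => tab; apply: fc; split.
have V x : a <= x <= b -> ccont `[c, d] (fun y => f (x +i* y)).
  move=> xab; apply: (ccont_comp (f := f)); first exact: ccont_vertical.
  by move=> t; rewrite /= in_itv/= => tab; apply: fc; split.
rewrite (rect_split_re am mb); try by apply: H; rewrite ?lexx ltW.
by rewrite !(rect_split_im cn nd)//; apply: V; rewrite ?lexx ?am ?mb//= ltW.
Qed.

Lemma midpointP a b : a < b -> [/\ a < (a + b) / 2, (a + b) / 2 < b,
  (a + b) / 2 - a = (b - a) / 2 & b - (a + b) / 2 = (b - a) / 2].
Proof. by move=> ab; split; lra. Qed.

Lemma dist_in_segment a b x y : a <= x <= b -> a <= y <= b -> `|x - y| <= b - a.
Proof.
by move=> /andP[? ?] /andP[? ?]; rewrite ler_norml; apply/andP; split; lra.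
Qed.

(** The fourth quarter is returned without a test: when the whole rectangle is bad and the other
    three quarters are not, subadditivity of the norm makes it bad. *)
Definition quarter (bad : R * R * R * R -> bool) (s : R * R * R * R) :=
  let: (a, b, c, d) := s in
  let m := (a + b) / 2 in let n := (c + d) / 2 in
  if bad (a, m, c, n) then (a, m, c, n) else
  if bad (a, m, n, d) then (a, m, n, d) else
  if bad (m, b, c, n) then (m, b, c, n) else (m, b, n, d).

Theorem Goursat f a b c d : a < b -> c < d ->
  (forall z, rectangle a b c d z -> exists l, cderivable_at f z l) ->
  rect_integral f a b c d = 0.
Proof.
move=> ab cd fh.
have fc z : rectangle a b c d z -> ccontinuous_at f z.
  by move=> /fh[l]; exact: cderivable_ccontinuous.
(* The bound is quadratic in the half perimeter: halving both sides divides it by exactly 4, so it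
   is inherited from the four quarters, while near a point of differentiability the integral is of
   smaller order than this square. *)
suff H e : 0 < e -> normc (rect_integral f a b c d) <= e * ((b - a) + (d - c)) ^+ 2.
  apply: Normc.eq0_normc; apply/eqP; rewrite eq_le normc_ge0 andbT.
  apply/ler_addgt0Pr => e e0; rewrite add0r.
  have h0 : 0 < ((b - a) + (d - c)) ^+ 2 by rewrite exprn_gt0//; lra.
  have := H (e / ((b - a) + (d - c)) ^+ 2) (divr_gt0 e0 h0).
  by rewrite mulfVK// gt_eqF.
move=> e0; apply/negPn/negP => bad0.
pose h := (b - a) + (d - c).
pose bad (s : R * R * R * R) := let: (a, b, c, d) := s in
  ~~ (normc (rect_integral f a b c d) <= e * ((b - a) + (d - c)) ^+ 2).
pose inv n (s : R * R * R * R) := let: (a', b', c', d') := s in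
  [/\ bad s, a' < b' /\ c' < d', a <= a' /\ b' <= b, c <= c' /\ d' <= d &
    b' - a' + (d' - c') = h / 2 ^+ n].
pose sub (s s' : R * R * R * R) := let: (a', b', c', d') := s in
  let: (a1, b1, c1, d1) := s' in a' <= a1 /\ b1 <= b' /\ c' <= c1 /\ d1 <= d'.
have step n s : inv n s -> inv n.+1 (quarter bad s) /\ sub s (quarter bad s).
  case: s => [[[a' b'] c'] d'] [] bads [ab' cd'] [aa bb] [cc dd] hE.
  have [a1 a2 a3 a4] := midpointP ab'; have [c1 c2 c3 c4] := midpointP cd'.
  have Q u v u' v' : bad (u, v, u', v') -> u < v -> u' < v' -> a' <= u -> v <= b' ->
      c' <= u' -> v' <= d' -> v - u = (b' - a') / 2 -> v' - u' = (d' - c') / 2 ->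
      inv n.+1 (u, v, u', v') /\ sub (a', b', c', d') (u, v, u', v').
    move=> buv uv uv' au vb cu vd E E'; split=> //; split=> //.
    - by split; [exact: le_trans aa au|exact: le_trans vb bb].
    - by split; [exact: le_trans cc cu|exact: le_trans vd dd].
    - by rewrite E E' -mulrDl hE exprSr invfM mulrA.
  rewrite /quarter; case: ifPn => [b1|/negPn b1]; first by apply: Q => //; exact: ltW.
  case: ifPn => [b2|/negPn b2]; first by apply: Q => //; exact: ltW.
  case: ifPn => [b3|/negPn b3]; first by apply: Q => //; exact: ltW.
  apply: Q => //; try exact: ltW.
  apply/negP => b4; move/negP: bads; apply.
  rewrite rect_quarters//; last by move=> z /(rectangle_sub aa bb cc dd); exact: fc.
  have eE : e * (b' - a' + (d' - c')) ^+ 2 =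
      (e * ((b' - a' + (d' - c')) / 2) ^+ 2 + e * ((b' - a' + (d' - c')) / 2) ^+ 2) +
      (e * ((b' - a' + (d' - c')) / 2) ^+ 2 + e * ((b' - a' + (d' - c')) / 2) ^+ 2).
    by field.
  rewrite eE; apply: le_trans (normcD _ _) _.
  apply: lerD; apply: le_trans (normcD _ _) _; apply: lerD.
  - by move: b1; rewrite a3 c3 -mulrDl.
  - by move: b2; rewrite a3 c4 -mulrDl.
  - by move: b3; rewrite a4 c3 -mulrDl.
  - by move: b4; rewrite a4 c4 -mulrDl.
pose s n := iter n (quarter bad) (a, b, c, d).
have invs n : inv n (s n).
  elim: n => [|n ih]; last by have [] := step _ _ ih.
  by split=> //; rewrite /h expr0 divr1.
have subs n : sub (s n) (s n.+1) by have [] := step _ _ (invs n).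
pose A n := (s n).1.1.1; pose B n := (s n).1.1.2.
pose C n := (s n).1.2; pose D n := (s n).2.
have sE n : s n = (A n, B n, C n, D n).
  by rewrite /A /B /C /D; case: (s n) => [[[]]].
have [x xAB] : exists x, forall n, A n <= x <= B n.
  by apply: nested_segments => n; [have := subs n|have := subs n|have := invs n];
    rewrite !sE => -[]; [|move=> _ []|move=> _ [/ltW]].
have [y yCD] : exists y, forall n, C n <= y <= D n.
  by apply: nested_segments => n; [have := subs n|have := subs n|have := invs n];
    rewrite !sE => -[]; [move=> _ [_ []]|move=> _ [_ []]|move=> _ [_ /ltW]].
pose p := x +i* y.
have [l fl] : exists l, cderivable_at f p l.
  by apply: fh; have := xAB 0%N; have := yCD 0%N; split.
(* The divisor 4 compensates the constant 4 of [normc_rect_integral]. *)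
have e40 : 0 < e / 4 by rewrite divr_gt0.
have [r r0 fr] := fl _ e40.
have h0 : 0 < h by rewrite /h; lra.
have [n hn] : exists n, h / 2 ^+ n < r.
  have := @cvg_geometric R h (2^-1).
  rewrite ger0_norm ?invr_ge0// invf_lt1// ltr1n => /(_ isT)/cvgrPdist_lt/(_ _ r0)[n _ /(_ n)].
  rewrite /= leqnn => /(_ isT); rewrite sub0r normrN ger0_norm.
    by rewrite /geometric /= exprVn => ?; exists n.
  by rewrite /geometric /= mulr_ge0 ?exprn_ge0 ?invr_ge0// ltW.
have := invs n; rewrite sE => -[/negP + [ABn CDn] [aA bB] [cC dD] hE]; apply.
(* The subtracted affine part integrates to zero around any rectangle, so only this remainder
   counts. Both it and the half perimeter are bounded through [h / 2 ^+ n], whence the square. *)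
pose g z := f z - f p - l * (z - p).
have wp z : rectangle (A n) (B n) (C n) (D n) z -> normc (z - p) <= h / 2 ^+ n.
  move=> [z1 z2]; rewrite (le_trans (normc_le_ReIm _))// -hE ReB ImB /=.
  by apply: lerD; exact: dist_in_segment.
have gb z : rectangle (A n) (B n) (C n) (D n) z -> normc (g z) <= e / 4 * (h / 2 ^+ n).
  move=> zr; apply: le_trans (fr _ _) _; first exact: le_lt_trans (wp _ zr) hn.
  by rewrite ler_wpM2l// ?(ltW e40)// wp.
have fcn : con_edges f (A n) (B n) (C n) (D n).
  apply: ccont_edges => z /(edges_rectangle (ltW ABn) (ltW CDn)).
  by move=> /(rectangle_sub aA bB cC dD); exact: fc.
have cl : con_edges (fun z => (- f p) + (- l) * (z - p)) (A n) (B n) (C n) (D n).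
  apply: con_edgesD; first exact: con_edges_cst.
  apply: con_edgesM; first exact: con_edges_cst.
  by apply: con_edgesD; [exact: con_edges_id|exact: con_edges_cst].
have -> : rect_integral f (A n) (B n) (C n) (D n) = rect_integral g (A n) (B n) (C n) (D n).
  have := rect_integralD fcn cl; rewrite rect_affine// addr0 => <-.
  apply: eq_rect_integral; rewrite ?ltW// => z _.
  by rewrite /g mulNr addrA.
apply: le_trans (normc_rect_integral (M := e / 4 * (h / 2 ^+ n)) _ _ _ _) _.
- exact: ltW.
- exact: ltW.
- have -> : g = (fun z => f z + ((- f p) + (- l) * (z - p))).
    by apply/funext => z; rewrite /g mulNr addrA.
  exact: con_edgesD.
- by move=> z /(edges_rectangle (ltW ABn) (ltW CDn)); exact: gb.
- by rewrite hE le_eqVlt; apply/orP; left; apply/eqP; field; rewrite expf_neq0.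
Qed.

End Goursat.

(** * Cauchy's formula on rectangles *)

Section CauchyExpansion.
Context {R : realType}.
Implicit Types (a b c d t x y e r rho : R) (f g : R[i] -> R[i]) (z w p q : R[i]).

Lemma derivable_subc f z w : derivable (f : R[i]^o -> R[i]^o) w 1 ->
  derivable ((fun w => f w - z) : R[i]^o -> R[i]^o) w 1.
Proof.
rewrite /derivable => fw.
rewrite (_ : (fun h => _) = (fun h : R[i]^o => h^-1 *: ((f \o shift w) (h *: 1) - f w)))//.
by apply/funext => h; congr (_ *: _); rewrite /= opprB addrA subrK.
Qed.

Lemma derivable_subcV z w : w != z ->
  derivable ((fun w => (w - z)^-1) : R[i]^o -> R[i]^o) w 1.
Proof.
move=> wz; apply: (@derivableV R[i] R[i]^o (fun w : R[i]^o => (w - z : R[i]))).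
  by rewrite subr_eq0.
by apply: (@derivable_subc id); exact: derivable_id.
Qed.

Lemma con_edges_bounded f a b c d : a <= b -> c <= d -> con_edges f a b c d ->
  exists2 M : R, 0 <= M & forall z, edges a b c d z -> normc (f z) <= M.
Proof.
move=> ab cd [[f1 f2] [f3 f4]].
have [M1 M10 H1] := ccont_bounded ab f1; have [M2 M20 H2] := ccont_bounded ab f2.
have [M3 M30 H3] := ccont_bounded cd f3; have [M4 M40 H4] := ccont_bounded cd f4.
exists (M1 + M2 + M3 + M4); first by lra.
move=> [u v]; rewrite /edges /= => -[[uab [->|->]]|[vcd [->|->]]].
- by have := H1 u; rewrite in_itv/= uab => /(_ isT); lra.
- by have := H2 u; rewrite in_itv/= uab => /(_ isT); lra.
- by have := H4 v; rewrite in_itv/= vcd => /(_ isT); lra.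
- by have := H3 v; rewrite in_itv/= vcd => /(_ isT); lra.
Qed.

(** The frame between the rectangle and the inner square is cut into four rectangles avoiding the
    exceptional point: full-height strips on the left and right, then the pieces below and above the
    square. Goursat's theorem annihilates each. *)
Lemma rect_hole f a b c d x y s : 0 < s -> a < x - s -> x + s < b ->
  c < y - s -> y + s < d ->
  (forall z, rectangle a b c d z -> z != x +i* y -> exists l, cderivable_at f z l) ->
  rect_integral f a b c d = rect_integral f (x - s) (x + s) (y - s) (y + s).
Proof.
move=> s0 ax xb cy yd fh.
have fc z : rectangle a b c d z -> z != x +i* y -> ccontinuous_at f z.
  by move=> zr zp; have [l] := fh _ zr zp; exact: cderivable_ccontinuous.
have nexy u v : u != x \/ v != y -> u +i* v != x +i* y.
  by rewrite eq_complex/= negb_and => -[->|->]; rewrite ?orbT.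
have H v a' b' : a <= a' -> b' <= b -> c <= v <= d -> v != y ->
    ccont `[a', b'] (fun u => f (u +i* v)).
  move=> aa bb vcd vy; apply: (ccont_comp (f := f)); first exact: ccont_horizontal.
  move=> t; rewrite /= in_itv/= => /andP[t1 t2]; apply: fc; last by apply: nexy; right.
  by split=> //=; rewrite (le_trans aa)//= (le_trans t2).
have V u : a <= u <= b -> u != x -> ccont `[c, d] (fun v => f (u +i* v)).
  move=> uab ux; apply: (ccont_comp (f := f)); first exact: ccont_vertical.
  move=> t; rewrite /= in_itv/= => tab; apply: fc; last by apply: nexy; left.
  by split.
have G a' b' c' d' : a <= a' -> a' < b' -> b' <= b -> c <= c' -> c' < d' -> d' <= d ->
    [|| b' < x, x < a', d' < y | y < c'] -> rect_integral f a' b' c' d' = 0.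
  move=> ? ? ? ? ? ? out; apply: Goursat => // -[u v] [/= /andP[? ?] /andP[? ?]].
  apply: fh; first by split; apply/andP; split => /=; lra.
  by apply: nexy; case/or4P: out => ?;
    [left|left|right|right]; apply/negP => /eqP; lra.
have [a1 a2 a3] : [/\ a <= x - s, x - s <= x + s & x + s <= b] by split; lra.
have [c1 c2 c3] : [/\ c <= y - s, y - s <= y + s & y + s <= d] by split; lra.
have [ab cd] : a < b /\ c < d by split; lra.
have Hc a' : a <= a' -> ccont `[a', b] (fun u => f (u +i* c)).
  move=> ?; apply: H => //; first by rewrite lexx ltW.
  by rewrite lt_eqF//; lra.
have Hd a' : a <= a' -> ccont `[a', b] (fun u => f (u +i* d)).
  move=> ?; apply: H => //; first by rewrite lexx ltW.
  by rewrite gt_eqF//; lra.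
have V1 : ccont `[c, d] (fun v => f ((x - s) +i* v)).
  by apply: V; [apply/andP; split; lra|apply/negP => /eqP; lra].
have V2 : ccont `[c, d] (fun v => f ((x + s) +i* v)).
  by apply: V; [apply/andP; split; lra|apply/negP => /eqP; lra].
have sub : `[y - s, d]%classic `<=` `[c, d]%classic.
  by move=> t /=; rewrite !in_itv/= => /andP[? ?]; apply/andP; split; lra.
have G1 : rect_integral f a (x - s) c d = 0.
  by apply: G; try lra; apply/or4P; apply: Or41; lra.
have G2 : rect_integral f (x + s) b c d = 0.
  by apply: G; try lra; apply/or4P; apply: Or42; lra.
have G3 : rect_integral f (x - s) (x + s) c (y - s) = 0.
  by apply: G; try lra; apply/or4P; apply: Or43; lra.
have G4 : rect_integral f (x - s) (x + s) (y + s) d = 0.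
  by apply: G; try lra; apply/or4P; apply: Or44; lra.
rewrite (rect_split_re a1 (le_trans a2 a3) (Hc _ (lexx _)) (Hd _ (lexx _))) G1 add0r.
rewrite (rect_split_re a2 a3 (Hc _ a1) (Hd _ a1)) G2 addr0.
rewrite (rect_split_im c1 (le_trans c2 c3) V1 V2) G3 add0r.
by rewrite (rect_split_im c2 c3 (ccont_sub sub V1) (ccont_sub sub V2)) G4 addr0.
Qed.

Lemma edges_centered x y s w : 0 < s -> edges (x - s) (x + s) (y - s) (y + s) w ->
  [/\ w != x +i* y, `|Re w - x| <= s & `|Im w - y| <= s].
Proof.
case: w => u v s0; rewrite /edges/= => E; split.
- rewrite eq_complex/= negb_and; apply/orP.
  by case: E => [[_ [->|->]]|[_ [->|->]]]; [right|right|left|left];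
    apply/negP => /eqP; lra.
- by rewrite ler_norml; case: E => [[/andP[? ?] _]|[_ [->|->]]]; apply/andP; split; lra.
- by rewrite ler_norml; case: E => [[_ [->|->]]|[/andP[? ?] _]]; apply/andP; split; lra.
Qed.

(** The difference quotient of [f] at [z] is bounded near [z], and by [rect_hole] its integral
    equals the one around an arbitrarily small square, so it vanishes. The integral of [(w - z)^-1]
    is left unevaluated. *)
Lemma Cauchy_rect f a b c d z : a < Re z < b -> c < Im z < d ->
  (forall w, rectangle a b c d w -> derivable (f : R[i]^o -> R[i]^o) w 1) ->
  rect_integral (fun w => f w / (w - z)) a b c d =
  f z * rect_integral (fun w => (w - z)^-1) a b c d.
Proof.
case: z => x y /= /andP[ax xb] /andP[cy yd] fh; set z := x +i* y.
have ab : a <= b by lra.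
have cd : c <= d by lra.
have ne w : edges a b c d w -> w - z != 0.
  case: w => u v; rewrite subr_eq0 eq_complex /edges/= negb_and.
  by move=> [[_ [->|->]]|[_ [->|->]]]; apply/orP;
    [right|right|left|left]; apply/negP => /eqP; lra.
have cV : con_edges (fun w => (w - z)^-1) a b c d.
  apply: ccont_edges => w we.
  have [l] : exists l, cderivable_at (fun w => (w - z)^-1) w l.
    by apply: derivable_cderivable; apply: derivable_subcV; rewrite -subr_eq0 ne.
  exact: cderivable_ccontinuous.
have cf : con_edges f a b c d.
  apply: ccont_edges => w /(edges_rectangle ab cd)/fh/derivable_cderivable[l].
  exact: cderivable_ccontinuous.
pose g w := (f w - f z) * (w - z)^-1.
have cfz : con_edges (fun w => - f z * (w - z)^-1) a b c d.
  by apply: con_edgesM => //; exact: con_edges_cst.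
have gE : rect_integral g a b c d =
    rect_integral (fun w => f w / (w - z)) a b c d -
    f z * rect_integral (fun w => (w - z)^-1) a b c d.
  rewrite -mulNr -(rect_integralZ (- f z))// -rect_integralD//; last exact: con_edgesM.
  by apply: eq_rect_integral => // w _; rewrite /g mulrBl mulNr.
apply/eqP; rewrite -subr_eq0 -gE.
have gh w : rectangle a b c d w -> w != z -> exists l, cderivable_at g w l.
  move=> wr wz; apply: derivable_cderivable.
  apply: (@derivableM R[i] R[i]^o (fun w => f w - f z) (fun w => (w - z)^-1)).
    by apply: derivable_subc; exact: fh.
  exact: derivable_subcV.
have [l fl] : exists l, cderivable_at f z l.
  by apply: derivable_cderivable; apply: fh; split; apply/andP; split => /=; lra.
have [r r0 fr] := fl 1 ltr01.
rewrite -normc_eq0 eq_le normc_ge0 andbT; apply/ler_addgt0Pr => e e0; rewrite add0r.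
pose K := 1 + normc l.
have K0 : 0 < K by rewrite /K ltr_pwDl// normc_ge0.
pose m := Num.min (Num.min (x - a) (b - x)) (Num.min (y - c) (d - y)).
(* [m / 2] keeps the square inside the rectangle, [r / 4] keeps its edges where the derivative
   estimate holds, and [e / (16 * K)] makes the final bound [4 * K * (2 * s + 2 * s)] at most
   [e]. *)
pose s := Num.min (m / 2) (Num.min (r / 4) (e / (16 * K))).
have m0 : 0 < m by rewrite !lt_min !subr_gt0 ax xb cy yd.
have s0 : 0 < s by rewrite !lt_min !divr_gt0// mulr_gt0.
have sm : s < m by rewrite gt_min; apply/orP; left; lra.
have sr : s <= r / 4 by rewrite !ge_min lexx orbT.
have ssr : s + s < r by lra.
have se : s <= e / (16 * K) by rewrite !ge_min lexx !orbT.
move: (sm); rewrite !lt_min => /andP[/andP[? ?] /andP[? ?]].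
have [h1 h2 h3 h4] : [/\ a < x - s, x + s < b, c < y - s & y + s < d] by split; lra.
have sx : x - s <= x + s by lra.
have sy : y - s <= y + s by lra.
rewrite (@rect_hole g a b c d x y s)//.
have sE w := @edges_centered x y s w s0.
apply: le_trans (normc_rect_integral (M := K) sx sy _ _) _.
- apply: ccont_edges => w we; have [wz _ _] := sE _ we.
  have /gh/(_ wz)[l' ] : rectangle a b c d w.
    by apply: (rectangle_sub (ltW h1) (ltW h2) (ltW h3) (ltW h4)); exact: edges_rectangle we.
  exact: cderivable_ccontinuous.
- move=> [u v] uv; have [uvz ux vy] := sE _ uv.
  have uvz0 : 0 < normc (u +i* v - z) by rewrite normc_gt0 subr_eq0.
  rewrite /g Normc.normcM Normc.normcV ler_pdivrMr//.
  have -> : f (u +i* v) - f z = (f (u +i* v) - f z - l * (u +i* v - z)) + l * (u +i* v - z).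
    by rewrite subrK.
  apply: le_trans (normcD _ _) _; rewrite Normc.normcM /K mulrDl lerD2r.
  apply: fr; apply: le_lt_trans (normc_le_ReIm _) _.
  by rewrite ReB ImB /=; exact: le_lt_trans (lerD ux vy) ssr.
- rewrite (_ : 4 * K * _ = 16 * K * s); last by ring.
  by move: se; rewrite ler_pdivlMr ?mulr_gt0// mulrC.
Qed.

End CauchyExpansion.

(** * Power series on a disc inscribed in a square *)

Section TaylorExpansion.
Context {R : realType}.
Implicit Types (a b c d t x y e : R) (f g : R[i] -> R[i]) (z w p : R[i]).

Lemma geometric_kernel (w z : R[i]) N : w != 0 -> w != z ->
  (w - z)^-1 = \sum_(n < N) z ^+ n * w^-1 ^+ n.+1 + (z / w) ^+ N * (w - z)^-1.
Proof.
move=> w0 wz; have wz0 : w - z != 0 by rewrite subr_eq0.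
elim: N => [|N ih]; first by rewrite big_ord0 add0r expr0 mul1r.
rewrite big_ord_recr /= -addrA {1}ih; congr (_ + _).
rewrite !expr_div_n !exprSr !exprVn.
have wN : w ^+ N != 0 by rewrite expf_neq0.
by field; rewrite wN w0 wz0.
Qed.

Lemma Rintegral_ge_cst a b (k : R -> R) m : a < b ->
  lebesgue_measure.-integrable `[a, b] (EFin \o k) ->
  (forall t, t \in `[a, b] -> m <= k t) ->
  m * (b - a) <= \int[lebesgue_measure]_(t in `[a, b]) k t.
Proof.
move=> ab ki mk.
have -> : m * (b - a) = \int[lebesgue_measure]_(t in `[a, b]) m.
  by rewrite Rintegral_cst//= lebesgue_measure_itv/= lte_fin ab.
apply: le_Rintegral => //.
by apply: (continuous_compact_integrable (@segment_compact R a b)) => t; exact: cvg_cst.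
Qed.

Variables (c r : R).
Hypothesis r0 : 0 < r.
Local Notation q := (c%:C : R[i]).
Local Notation sq F := (rect_integral F (c - r) (c + r) (- r) r).
Local Notation sq_edges := (edges (c - r) (c + r) (- r) r).
Local Notation sq_con F := (con_edges F (c - r) (c + r) (- r) r).
Local Notation kappa := (sq (fun w => (w - q)^-1)).

Let cr : c - r < c + r. Proof. by move: r0; lra. Qed.
Let rr : - r < r. Proof. by move: r0; lra. Qed.

Lemma edges_dist w : sq_edges w -> r <= normc (w - q).
Proof.
case: w => u v; rewrite /edges/= => E.
suff [H|H] : r <= `|u - c| \/ r <= `|v|.
- by apply: le_trans H _; have := Re_le_normc (u +i* v - q); rewrite ReB.
- by apply: le_trans H _; have := Im_le_normc (u +i* v - q); rewrite ImB /= subr0.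
case: E => [[_ [->|->]]|[_ [->|->]]].
- by right; rewrite normrN gtr0_norm.
- by right; rewrite gtr0_norm.
- by left; rewrite addrAC subrr add0r normrN gtr0_norm.
- by left; rewrite addrAC subrr add0r gtr0_norm.
Qed.

Lemma con_edges_inv z : normc (z - q) < r -> sq_con (fun w => (w - z)^-1).
Proof.
move=> zr; apply: ccont_edges => w we.
have [l] : exists l, cderivable_at (fun w => (w - z)^-1) w l.
  apply: derivable_cderivable; apply: derivable_subcV.
  apply/eqP => wz; move: zr; rewrite -wz ltNge => /negP; apply.
  exact: edges_dist.
exact: cderivable_ccontinuous.
Qed.

Lemma con_edges_invX n : sq_con (fun w => (w - q)^-1 ^+ n).
Proof.
elim: n => [|n ih]; first exact: con_edges_cst.
rewrite (_ : (fun w => _) = (fun w => (w - q)^-1 * (w - q)^-1 ^+ n)).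
  apply: con_edgesM => //; apply: con_edges_inv.
  by rewrite subrr Normc.normc0.
by apply/funext => w; rewrite exprS.
Qed.

Lemma sq_sum (F : nat -> R[i] -> R[i]) N : (forall n, sq_con (F n)) ->
  sq (fun w => \sum_(n < N) F n w) = \sum_(n < N) sq (F n) /\
  sq_con (fun w => \sum_(n < N) F n w).
Proof.
move=> Fc; elim: N => [|N [ih1 ih2]].
  have E0 : (fun w => \sum_(n < 0) F n w) = (fun=> 0 * 0).
    by apply/funext => w; rewrite big_ord0 mul0r.
  rewrite E0 rect_integralZ; last exact: con_edges_cst.
  by rewrite mul0r big_ord0; split=> //; exact: con_edges_cst.
have ES : (fun w => \sum_(n < N.+1) F n w) = (fun w => \sum_(n < N) F n w + F N w).
  by apply/funext => w; rewrite big_ord_recr.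
rewrite ES rect_integralD// big_ord_recr /= ih1; split=> //.
exact: con_edgesD.
Qed.

(** [g] is only continuous on the edges, since the expansion is that of the kernel [(w - z)^-1]. It
    is applied to [f] and also to the constant 1, which yields [rect_inv]. *)
Lemma Cauchy_kernel_expansion g M rho : sq_con g -> 0 <= M ->
  (forall w, sq_edges w -> normc (g w) <= M) -> 0 <= rho -> rho < r ->
  forall z N, normc (z - q) <= rho ->
  normc (sq (fun w => g w / (w - z)) -
         \sum_(n < N) sq (fun w => g w * (w - q)^-1 ^+ n.+1) * (z - q) ^+ n) <=
  16 * M * r / (r - rho) * (rho / r) ^+ N.
Proof.
move=> gc M0 gM rho0 rhor z N zr.
have zr' : normc (z - q) < r by exact: le_lt_trans rhor.
have dist w : sq_edges w -> r - rho <= normc (w - z).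
  move=> /edges_dist; have := normcD (w - z) (z - q); rewrite addrA subrK.
  by move: zr; lra.
have ne w : sq_edges w -> w - z != 0.
  by move=> /dist H; rewrite -normc_gt0; move: rhor; lra.
have neq w : sq_edges w -> w - q != 0.
  by move=> /edges_dist H; rewrite -normc_gt0; move: r0; lra.
have Tc n : sq_con (fun w => (z - q) ^+ n * (g w * (w - q)^-1 ^+ n.+1)).
  apply: con_edgesM; first exact: con_edges_cst.
  by apply: con_edgesM => //; exact: con_edges_invX.
have [sE sC] := sq_sum N Tc.
(* The remainder of the finite geometric series. On the edges the ratio is at most [rho / r] and the
   last factor at most [(r - rho)^-1]; the half perimeter [4 * r] and the constant of
   [normc_rect_integral] make up the 16. *)
pose rem w := ((z - q) / (w - q)) ^+ N * (g w * (w - z)^-1).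
have rc : sq_con rem.
  have -> : rem = (fun w => ((z - q) ^+ N * (w - q)^-1 ^+ N) * (g w * (w - z)^-1)).
    by apply/funext => w; rewrite /rem expr_div_n exprVn.
  apply: con_edgesM; last by apply: con_edgesM => //; exact: con_edges_inv.
  by apply: con_edgesM; [exact: con_edges_cst|exact: con_edges_invX].
have -> : sq (fun w => g w / (w - z)) =
    \sum_(n < N) sq (fun w => g w * (w - q)^-1 ^+ n.+1) * (z - q) ^+ n + sq rem.
  rewrite (eq_bigr (fun n : 'I_N => sq (fun w => (z - q) ^+ n * (g w * (w - q)^-1 ^+ n.+1)))).
    rewrite -sE -rect_integralD//.
    apply: eq_rect_integral => [||w we]; [exact: ltW|exact: ltW|].
    have := @geometric_kernel (w - q) (z - q) N (neq _ we).
    rewrite -subr_eq0 opprB addrA subrK => /(_ (ne _ we)) ->.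
    rewrite mulrDr mulr_sumr /rem; congr (_ + _); last by ring.
    by apply: eq_bigr => n _; ring.
  move=> n _; rewrite rect_integralZ; first by rewrite mulrC.
  by apply: con_edgesM => //; exact: con_edges_invX.
rewrite addrAC subrr add0r.
have d0 : 0 < r - rho by rewrite subr_gt0.
apply: le_trans (normc_rect_integral (M := (rho / r) ^+ N * (M / (r - rho))) _ _ rc _) _.
- exact: ltW.
- exact: ltW.
- move=> w we; rewrite /rem !Normc.normcM normcX Normc.normcM !Normc.normcV.
  have q0 : 0 < normc (w - q) by rewrite normc_gt0 neq.
  have z0 : 0 < normc (w - z) by rewrite normc_gt0 ne.
  apply: ler_pM.
  + by rewrite exprn_ge0// divr_ge0 ?normc_ge0.
  + by rewrite divr_ge0 ?normc_ge0.
  + rewrite lerXn2r ?nnegrE ?divr_ge0 ?normc_ge0// ?(ltW r0)//.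
    by apply: ler_pM; rewrite ?invr_ge0 ?normc_ge0// lef_pV2// edges_dist.
  + apply: ler_pM; rewrite ?invr_ge0 ?normc_ge0 ?gM//.
    by rewrite lef_pV2// dist.
- rewrite (_ : c + r - (c - r) + (r - - r) = 4 * r); last by ring.
  by rewrite le_eqVlt; apply/orP; left; apply/eqP; ring.
Qed.

(** The value is that of [two_pi_i], but a divisor only has to be nonzero: each of the four edges
    contributes at least 1 to the imaginary part. *)
Lemma kappa_neq0 : kappa != 0.
Proof.
have q0 : normc (q - q) < r by rewrite subrr Normc.normc0.
have [[k1 k2] [k3 k4]] := con_edges_inv q0.
(* On each edge the relevant component of the integrand has the form on the right, up to sign;
   integrating the lower bound over length [2 * r] gives 1. *)
have bnd x : `|x| <= r -> (2 * r)^-1 <= r / (x ^+ 2 + r ^+ 2).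
  move=> xr; have x2 : x ^+ 2 <= r ^+ 2.
    by rewrite -real_normK ?num_real// lerXn2r ?nnegrE// ltW.
  have r2 : 0 < r ^+ 2 by rewrite exprn_gt0.
  have p0 : 0 < x ^+ 2 + r ^+ 2 by rewrite ltr_wpDl ?sqr_ge0.
  rewrite ler_pdivlMr// mulrC ler_pdivrMr ?mulr_gt0//.
  by rewrite mulrCA -expr2 mulr2n mulrDl !mul1r lerD2r.
have inv2 : (2 * r)^-1 * (r - - r) = 1 by field; rewrite gt_eqF.
have inv2' : (2 * r)^-1 * (c + r - (c - r)) = 1.
  by rewrite -[RHS]inv2; congr (_ * _); ring.
have near_c t : t \in `[c - r, c + r] -> `|t - c| <= r.
  by rewrite in_itv/= ler_norml => /andP[? ?]; apply/andP; split; lra.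
have near_0 t : t \in `[- r, r] -> `|t| <= r by rewrite in_itv/= ler_norml.
pose I1 := cint (c - r) (c + r) (fun x => (x +i* (- r) - q)^-1).
pose I2 := cint (c - r) (c + r) (fun x => (x +i* r - q)^-1).
pose I3 := cint (- r) r (fun y => ((c + r) +i* y - q)^-1).
pose I4 := cint (- r) r (fun y => ((c - r) +i* y - q)^-1).
have h1 : 1 <= Im I1.
  rewrite -inv2'; apply: Rintegral_ge_cst => //; first by case: (ccont_integrable k1).
  move=> t /near_c tc; rewrite ImV !ReImE /= subr0 mulNr opprK sqrrN; exact: bnd.
have h2 : 1 <= Im (- I2).
  have k2' : ccont `[c - r, c + r] (fun x => 0 - (x +i* r - q)^-1).
    by apply: ccontB => //; exact: ccont_cst.
  rewrite -cintN; last exact: ccont_integrable.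
  rewrite -inv2'; apply: Rintegral_ge_cst => //.
    by case: (ccont_integrable k2') => _; apply: eq_integrable => // t _; rewrite /= sub0r.
  move=> t /near_c tc; rewrite ImN ImV opprK !ReImE /= subr0; exact: bnd.
have h3 : 1 <= Re I3.
  rewrite -inv2; apply: Rintegral_ge_cst => //; first by case: (ccont_integrable k3).
  move=> t /near_0 tc; rewrite ReV !ReImE /= subr0 addrAC subrr add0r addrC; exact: bnd.
have h4 : 1 <= Re (- I4).
  have k4' : ccont `[- r, r] (fun y => 0 - ((c - r) +i* y - q)^-1).
    by apply: ccontB => //; exact: ccont_cst.
  rewrite -cintN; last exact: ccont_integrable.
  rewrite -inv2; apply: Rintegral_ge_cst => //.
    by case: (ccont_integrable k4') => + _; apply: eq_integrable => // t _; rewrite /= sub0r.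
  move=> t /near_0 tc; rewrite ReN ReV !ReImE /= subr0 addrAC subrr add0r mulNr opprK sqrrN addrC.
  exact: bnd.
have ImK : Im kappa = Im I1 + Im (- I2) + (Re I3 + Re (- I4)).
  by rewrite /rect_integral -/I1 -/I2 -/I3 -/I4 !ReImE /=; ring.
apply/eqP => /(congr1 (@complex.Im R)); rewrite ImK (_ : Im 0 = 0)// => H.
suff : 0 < Im I1 + Im (- I2) + (Re I3 + Re (- I4)) by rewrite H ltxx.
by rewrite !addr_gt0// (lt_le_trans ltr01).
Qed.

(** The exponent starts at 1 so that the term of index 0 can be split off a sum beforehand, as in
    [rect_inv]. *)
Lemma le0_geometric (x K s : R) : 0 <= s -> s < 1 -> 
  (forall N : nat, x <= K * s ^+ N.+1) -> x <= 0.
Proof.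
move=> s0 s1 H; apply/ler_addgt0Pr => e e0; rewrite add0r.
have := @cvg_geometric R K s; rewrite ger0_norm// => /(_ s1)/cvgrPdist_lt/(_ _ e0)[n _].
move=> /(_ n.+1 (leqnSn _)); rewrite /geometric /= sub0r normrN => h.
exact: le_trans (H n) (ltW (le_lt_trans (ler_norm _) h)).
Qed.

(** In the expansion with [g = 1] every term but the first is the integral of a power of
    [(w - q)^-1] with exponent at least 2. Such powers have primitives, so only [kappa] survives. *)
Lemma rect_inv z rho : 0 <= rho -> rho < r -> normc (z - q) <= rho ->
  sq (fun w => (w - z)^-1) = kappa.
Proof.
move=> rho0 rhor zr.
have ne w : sq_edges w -> w != q.
  by move=> /edges_dist H; rewrite -subr_eq0 -normc_gt0; exact: lt_le_trans H.
have n1 w : sq_edges w -> normc (1 : R[i]) <= 1 by rewrite Normc.normc1.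
have H N := Cauchy_kernel_expansion (con_edges_cst 1 _ _ _ _) ler01 n1 rho0 rhor N zr.
have E0 : sq (fun w => 1 * (w - z)^-1) = sq (fun w => (w - z)^-1).
  by apply: eq_rect_integral => [||w _]; rewrite ?mul1r// ltW.
have E1 n : sq (fun w => 1 * (w - q)^-1 ^+ n.+1) = sq (fun w => (w - q)^-1 ^+ n.+1).
  by apply: eq_rect_integral => [||w _]; rewrite ?mul1r// ltW.
apply/eqP; rewrite -subr_eq0 -normc_eq0 eq_le normc_ge0 andbT.
apply: (@le0_geometric _ (16 * 1 * r / (r - rho)) (rho / r)).
- by rewrite divr_ge0// ltW.
- by rewrite ltr_pdivrMr// mul1r.
move=> N; move: (H N.+1); rewrite big_ord_recl /= E0 E1 expr0 mulr1.
rewrite [\sum_(i < N) _]big1 ?addr0// => n _; rewrite E1 (rect_primitive _ _ (cprimitiveXV q n)) ?mul0r//.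
Qed.

Theorem disc_expansion f rho : 0 <= rho -> rho < r ->
  (forall w, rectangle (c - r) (c + r) (- r) r w ->
     derivable (f : R[i]^o -> R[i]^o) w 1) ->
  exists2 K : R, 0 <= K & exists2 d : nat -> R[i], forall n, normc (d n) <= K / r ^+ n &
    forall N z, normc (z - q) <= rho ->
      normc (f z - \sum_(n < N) d n * (z - q) ^+ n) <= K * (rho / r) ^+ N.
Proof.
move=> rho0 rhor fh.
have fc : sq_con f.
  apply: ccont_edges => w /(edges_rectangle (ltW cr) (ltW rr))/fh/derivable_cderivable[l].
  exact: cderivable_ccontinuous.
have [M M0 fM] := con_edges_bounded (ltW cr) (ltW rr) fc.
have k0 := kappa_neq0; have nk0 : 0 < normc kappa by rewrite normc_gt0.
have rr0 : 0 < r - rho by rewrite subr_gt0.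
pose J n := sq (fun w => f w * (w - q)^-1 ^+ n.+1).
(* [K1] serves the coefficients and [K2] the remainder; their sum is a common constant. *)
pose K1 := 16 * M / normc kappa; pose K2 := 16 * M * r / (r - rho) / normc kappa.
have K10 : 0 <= K1 by rewrite /K1 divr_ge0 ?mulr_ge0// ltW.
have K20 : 0 <= K2 by rewrite /K2 !divr_ge0 ?mulr_ge0// ltW.
exists (K1 + K2); first exact: addr_ge0.
exists (fun n => J n / kappa).
  move=> n; rewrite Normc.normcM Normc.normcV.
  apply: (@le_trans _ _ (K1 / r ^+ n)); last first.
    by rewrite ler_wpM2r ?invr_ge0 ?exprn_ge0 ?lerDl// ltW.
  rewrite /K1 mulrAC ler_wpM2r ?invr_ge0 ?normc_ge0//.
  apply: le_trans (normc_rect_integral (M := M / r ^+ n.+1) _ _ _ _) _.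
  - exact: ltW.
  - exact: ltW.
  - by apply: con_edgesM => //; exact: con_edges_invX.
  - move=> w we; rewrite Normc.normcM normcX Normc.normcV -exprVn.
    apply: ler_pM; rewrite ?exprn_ge0 ?invr_ge0 ?normc_ge0 ?fM//.
    rewrite lerXn2r ?nnegrE ?invr_ge0 ?normc_ge0// ?(ltW r0)//.
    rewrite lef_pV2 ?posrE ?edges_dist//.
    exact: lt_le_trans (edges_dist we).
  - rewrite (_ : c + r - (c - r) + (r - - r) = 4 * r); last by ring.
    rewrite le_eqVlt; apply/orP; left; apply/eqP; rewrite exprS.
    have rn0 : r ^+ n != 0 by rewrite expf_neq0 ?gt_eqF.
    by field; rewrite rn0 gt_eqF.
move=> N z zr.
have zin : c - r < Re z < c + r /\ - r < Im z < r.
  have := le_trans (Re_le_normc _) zr; have := le_trans (Im_le_normc _) zr.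
  rewrite ReB ImB /= subr0 !ler_norml => /andP[? ?] /andP[? ?].
  by split; apply/andP; split; lra.
have := Cauchy_kernel_expansion fc M0 fM rho0 rhor N zr.
rewrite (Cauchy_rect zin.1 zin.2 fh) (rect_inv rho0 rhor zr) => H.
have -> : f z - \sum_(n < N) J n / kappa * (z - q) ^+ n =
    (f z * kappa - \sum_(n < N) J n * (z - q) ^+ n) / kappa.
  rewrite mulrBl mulfK// mulr_suml; congr (_ - _).
  by apply: eq_bigr => n _; rewrite mulrAC.
rewrite Normc.normcM Normc.normcV ler_pdivrMr//.
apply: le_trans H _.
apply: (@le_trans _ _ (K2 * (rho / r) ^+ N * normc kappa)).
  by rewrite [leRHS]mulrAC /K2 divfK// gt_eqF.
rewrite ler_wpM2r ?normc_ge0// ler_wpM2r ?exprn_ge0 ?divr_ge0 ?lerDr//.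
exact: ltW.
Qed.

End TaylorExpansion.

(** * The kernels T_f *)

Section TKernel.
Context {R : realType}.
Variables (a : nat -> R) (gamma : R -> R[i]).
Hypothesis a_gt0 : forall x, 0 < a x.
Hypothesis gammaC1 : piecewise_C1 gamma.
Hypothesis gamma_closed : gamma 0 = gamma 1.
Hypothesis gamma_a : forall x, positively_encircles gamma ((a x)%:C).
Implicit Types (f g : R[i] -> R[i]) (x y z n : nat) (w : R[i]).
Local Notation ointegral := (contour_integral gamma).
Local Notation p := (p_poly a).
Local Notation con := (con_curve gamma).

Lemma two_pi_i_neq0 : two_pi_i != 0 :> R[i].
Proof.
rewrite /two_pi_i eq_complex /= negb_and orbC mulf_neq0//.
by rewrite gt_eqF// pi_gt0.
Qed.

Lemma ac_neq0 x : (a x)%:C != 0 :> R[i].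
Proof. by rewrite eq_complex /= negb_and gt_eqF. Qed.

Lemma gamma_neq_a x (t : R) : t \in `[0, 1] -> gamma t != (a x)%:C.
Proof.
by move=> t01; have [H _] := gamma_a x; apply/eqP => E; apply: H; exists t.
Qed.

Lemma one_sub_div (b w : R[i]) : b != 0 -> 1 - w / b = - b^-1 * (w - b).
Proof. by move=> b0; rewrite mulrBr mulNr mulNr mulVf// opprK addrC mulrC. Qed.

Lemma p_polyS x w : p x.+1 w = p x w * (1 - w / (a x)%:C).
Proof. by rewrite /p_poly big_ord_recr. Qed.

Lemma p_neq0 x (t : R) : t \in `[0, 1] -> p x (gamma t) != 0.
Proof.
move=> t01; elim: x => [|x ih]; first by rewrite /p_poly big_ord0 oner_neq0.
rewrite p_polyS mulf_neq0// one_sub_div ?ac_neq0//.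
by rewrite mulf_neq0 ?oppr_eq0 ?invr_eq0 ?ac_neq0// subr_eq0 gamma_neq_a.
Qed.

Lemma con_p x : con (p x).
Proof.
elim: x => [|x ih].
  by apply: eq_ccont (ccont_cst _ 1) => t _; rewrite /p_poly big_ord0.
apply: eq_ccont (ccontM ih (_ : con (fun w => 1 - w / (a x)%:C))) => [t _|].
  by rewrite p_polyS.
apply: ccontB; first exact: ccont_cst.
by apply: ccontM; [exact: (con_curve_id gammaC1)|exact: ccont_cst].
Qed.

Lemma con_ratio x n : con (fun w => p x w / p n w).
Proof.
apply: ccontM; first exact: con_p.
apply: (@ccontV R `[0, 1]%classic (fun t => p n (gamma t))) => [t|]; last exact: con_p.
exact: p_neq0.
Qed.

(* [J_integral g x y.+1 = a y * T_kernel a g gamma x y]; with the extra value at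
   index [0], multiplying [g] by [w] acts on [J_integral] as a difference. *)
Definition J_integral g x n : R[i] :=
  - two_pi_i^-1 * ointegral (fun w => p x w / p n w * g w).

Lemma T_kernelE g x y : T_kernel a g gamma x y = ((a y)%:C)^-1 * J_integral g x y.+1.
Proof. by rewrite /T_kernel /J_integral; ring. Qed.

Lemma J_integralE g x y : J_integral g x y.+1 = (a y)%:C * T_kernel a g gamma x y.
Proof. by rewrite T_kernelE mulrA mulfV ?ac_neq0// mul1r. Qed.

Lemma con_mulw g : con g -> con (fun w => w * g w).
Proof. by move=> gc; apply: (ccontM (con_curve_id gammaC1) gc). Qed.

Lemma con_Jintegrand g x n : con g -> con (fun w => p x w / p n w * g w).
Proof. by move=> gc; apply: ccontM => //; exact: con_ratio. Qed.

Lemma T_kernelB g h x y : con g -> con h ->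
  T_kernel a (fun w => g w - h w) gamma x y = T_kernel a g gamma x y - T_kernel a h gamma x y.
Proof.
move=> gc hc; rewrite /T_kernel -mulrBr -contourB//; try exact: con_Jintegrand.
by congr (_ * _); apply: eq_contour => t _; rewrite mulrBr.
Qed.

Lemma T_kernelZ (k : R[i]) g x y : con g ->
  T_kernel a (fun w => k * g w) gamma x y = k * T_kernel a g gamma x y.
Proof.
move=> gc; rewrite /T_kernel [RHS]mulrCA -(contourZ gammaC1 k (con_Jintegrand x y.+1 gc)).
by congr (_ * _); apply: eq_contour => t _; rewrite mulrCA.
Qed.

Lemma T_kernel_sum N (c : nat -> R[i]) (F : nat -> R[i] -> R[i]) x y :
  (forall i, con (F i)) ->
  T_kernel a (fun w => \sum_(i < N) c i * F i w) gamma x y =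
  \sum_(i < N) c i * T_kernel a (F i) gamma x y.
Proof.
move=> Fc; rewrite /T_kernel.
transitivity (- two_pi_i^-1 / (a y)%:C * ointegral (fun w =>
    \sum_(i < N) c i * (p x w / p y.+1 w * F i w))).
  congr (_ * _); apply: eq_contour => t _; rewrite mulr_sumr.
  by apply: eq_bigr => i _; rewrite mulrCA.
rewrite (contour_sum gammaC1 N c (F := fun i w => p x w / p y.+1 w * F i w)); last first.
  by move=> i; exact: con_Jintegrand.
by rewrite mulr_sumr; apply: eq_bigr => i _; rewrite mulrCA.
Qed.

(** Since [p y.+1 w] is [p y w] times [1 - w / a y], the function w/(a_y p_{y+1}) equals 1/p_{y+1} -
    1/p_y. *)
Lemma T_kernel_mulw g x y : con g ->
  T_kernel a (fun w => w * g w) gamma x y = J_integral g x y.+1 - J_integral g x y.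
Proof.
move=> gc; rewrite T_kernelE /J_integral -mulrBr -contourB//; try exact: con_Jintegrand.
rewrite mulrCA -(contourZ gammaC1 _ (con_Jintegrand x y.+1 (con_mulw gc))).
congr (_ * _); apply: eq_contour => t t01.
have := p_neq0 y.+1 t01; have := p_neq0 y t01; rewrite p_polyS mulf_eq0 negb_or.
move=> py0 /andP[_ q0]; have ay := ac_neq0 y.
have ay' : (a y)%:C - gamma t != 0 by rewrite subr_eq0 eq_sym gamma_neq_a.
by field; rewrite py0 ay ay'.
Qed.

Lemma T_kernel_rowS g x y : con g ->
  T_kernel a g gamma x.+1 y = T_kernel a g gamma x y -
    ((a x)%:C)^-1 * (J_integral g x y.+1 - J_integral g x y).
Proof.
move=> gc; rewrite -T_kernel_mulw// -T_kernelZ; last exact: con_mulw.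
rewrite -T_kernelB//; last first.
  by apply: ccontM; [exact: ccont_cst|exact: con_mulw].
rewrite /T_kernel; congr (_ * _); apply: eq_contour => t _.
by rewrite p_polyS; ring.
Qed.

(** By [T_kernel_rowS] the sum telescopes. The hypothesis removes its lower boundary term, the
    integral of [p x] times [g] without denominator. *)
Lemma T_kernel_row_sum g x m : con g -> J_integral g x 0 = 0 ->
  \sum_(z < m.+1) T_kernel a g gamma x.+1 z - \sum_(z < m.+1) T_kernel a g gamma x z =
  - ((a m)%:C / (a x)%:C * T_kernel a g gamma x m).
Proof.
move=> gc J0; rewrite -sumrB.
rewrite (eq_bigr (fun z : 'I_m.+1 =>
    - ((a x)%:C)^-1 * (J_integral g x z.+1 - J_integral g x z))); last first.
  by move=> z _; rewrite T_kernel_rowS//; ring.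
rewrite -mulr_sumr -(big_mkord xpredT (fun z => J_integral g x z.+1 - J_integral g x z)).
by rewrite telescope_sumr// J0 subr0 J_integralE; ring.
Qed.

Lemma encircled_neq (b : R) t : positively_encircles gamma (b%:C) ->
  t \in `[0, 1] -> gamma t != b%:C.
Proof. by move=> [H _] t01; apply/eqP => E; apply: H; exists t. Qed.

Lemma con_inv_prod (s : seq R) :
  (forall b, b \in s -> positively_encircles gamma (b%:C)) ->
  con (fun w => \prod_(b <- s) (w - b%:C)^-1).
Proof.
elim: s => [|b s ih] sa.
  by apply: eq_ccont (ccont_cst _ 1) => t _; rewrite big_nil.
apply: eq_ccont (ccontM (_ : con (fun w => (w - b%:C)^-1)) (ih _)) => [t _||b' b's].
- by rewrite big_cons.
- apply: (@ccontV R `[0, 1]%classic (fun t => gamma t - b%:C)) => [t t01|].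
    by rewrite subr_eq0 encircled_neq//; apply: sa; rewrite mem_head.
  by apply: ccontB; [exact: (con_curve_id gammaC1)|exact: ccont_cst].
- by apply: sa; rewrite inE b's orbT.
Qed.

(** Values of [a] may coincide, so poles of any order occur. If all poles are equal there is a
    primitive; otherwise partial fractions at two distinct poles shorten the product, down to single
    poles whose integrals all equal [two_pi_i]. *)
Lemma contour_inv_prod (s : seq R) :
  (forall b, b \in s -> positively_encircles gamma (b%:C)) -> (1 < size s)%N ->
  ointegral (fun w => \prod_(b <- s) (w - b%:C)^-1) = 0.
Proof.
have [n] := ubnP (size s); elim: n s => // n ih [//|b [//|b0 s]] /=.
rewrite !ltnS => sn sa _.
have [/allP sb|/allPn[b' b's bb']] := boolP (all (pred1 b) (b0 :: s)).
  transitivity (ointegral (fun w => ((w - b%:C)^-1) ^+ (size s).+2)).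
    apply: eq_contour => t _; rewrite big_cons exprS; congr (_ * _).
    rewrite -[(size s).+1]/(size (b0 :: s)).
    elim: (b0 :: s) sb => [|b1 s1 ih1] sb; first by rewrite big_nil.
    rewrite big_cons exprS ih1; last by move=> u us; apply: sb; rewrite inE us orbT.
    by have /eqP -> := sb b1 (mem_head _ _).
  apply: (contour_primitive gammaC1 gamma_closed (cprimitiveXV b%:C (size s))).
  by move=> t t01; apply: encircled_neq => //; apply: sa; rewrite mem_head.
have ps : perm_eq (b0 :: s) (b' :: rem b' (b0 :: s)) by exact: perm_to_rem.
set s2 := rem b' (b0 :: s) in ps.
have size2 : size s2 = size s by rewrite /s2 size_rem.
have bin : b \in b :: b0 :: s by rewrite mem_head.
have b'in : b' \in b :: b0 :: s by rewrite inE b's orbT.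
have s2in u : u \in s2 -> u \in b :: b0 :: s.
  by move=> us; rewrite inE (perm_mem ps) !inE us !orbT.
have neb : b%:C - b'%:C != 0 :> R[i].
  by rewrite subr_eq0 eq_complex/= eqxx andbT eq_sym.
have H1 u : u \in b :: b0 :: s ->
    forall v, v \in u :: s2 -> positively_encircles gamma (v%:C).
  by move=> us v; rewrite inE => /predU1P[->|/s2in]; exact: sa.
(* The product of the two inverses at [b] and [b'] is their difference divided by [b - b']; [s2]
   lists the other poles. *)
transitivity ((b%:C - b'%:C)^-1 *
    (ointegral (fun w => \prod_(u <- b :: s2) (w - u%:C)^-1) -
     ointegral (fun w => \prod_(u <- b' :: s2) (w - u%:C)^-1))).
  rewrite -contourB//; try by apply: con_inv_prod; exact: H1.
  rewrite -contourZ//; last by apply: ccontB; apply: con_inv_prod; exact: H1.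
  apply: eq_contour => t t01; rewrite big_cons (perm_big _ ps) /= !big_cons.
  have h1 : gamma t - b%:C != 0 by rewrite subr_eq0 encircled_neq//; exact: sa.
  have h2 : gamma t - b'%:C != 0 by rewrite subr_eq0 encircled_neq//; exact: sa.
  by field; rewrite h1 h2 neb.
(* If other poles remain, both products fall under the induction hypothesis; if none remain, the two
   winding numbers cancel. *)
case: s2 size2 H1 {ps s2in} => [|b1 s2] size2 H1; last first.
  have sn2 : ((size s2).+2 < n)%N by move: sn; rewrite -size2.
  by rewrite !ih ?subr0 ?mulr0//=; exact: H1.
have wn u : u \in b :: b0 :: s ->
    ointegral (fun w => \prod_(v <- [:: u]) (w - v%:C)^-1) = two_pi_i.
  move=> us; have [_] := sa _ us; rewrite /winding_number => /(congr1 ( *%R two_pi_i)).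
  rewrite mulrA mulfV ?two_pi_i_neq0// mul1r mulr1 => <-.
  by apply: eq_contour => t _; rewrite big_seq1.
by rewrite !wn// subrr mulr0.
Qed.

(** At index 0 the denominator is the empty product, so the integrand is a polynomial. *)
Lemma J_integral_poly (q : {poly R[i]}) x : J_integral (fun w => q.[w]) x 0 = 0.
Proof.
rewrite /J_integral.
pose P := \prod_(k < x) (1 - ((a k)%:C)^-1 *: 'X : {poly R[i]}).
have PE w : P.[w] = p x w.
  rewrite /P horner_prod; apply: eq_bigr => k _.
  by rewrite !hornerE mulrC.
rewrite [ointegral _](_ : _ = ointegral (fun w => (P * q).[w])).
  by rewrite contour_poly ?mulr0.
by apply: eq_contour => t _; rewrite hornerM PE {2}/p_poly big_ord0 divr1.
Qed.

(** Biorthogonality of the functions p_x and 1/p_{y+1}. Only the row [x = 0] requires integration: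
    one pole when [y = 0], at least two when [y > 0]. The other rows follow from the row
    recursion. *)
Lemma T_kernel1 x y : T_kernel a (fun=> 1) gamma x y = (x == y)%:R.
Proof.
have J0 x' : J_integral (fun=> 1) x' 0 = 0.
  have := J_integral_poly 1 x'; rewrite /J_integral => <-.
  by congr (_ * _); apply: eq_contour => t _; rewrite hornerC.
elim: x y => [|x ih] y; last first.
  rewrite T_kernel_rowS ?ih; last exact: ccont_cst.
  case: y => [|y].
    rewrite J0 J_integralE ih subr0; case: eqP => [->|_]; last by rewrite !mulr0 subr0.
    by rewrite mulr1 mulVf ?ac_neq0// subrr.
  rewrite !J_integralE !ih eqSS; have [xy|_] := eqVneq x y.+1.
    rewrite xy [_.+1 == y]gtn_eqF// !mulr0 subr0 mulr1 mulVf ?ac_neq0// subrr//.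
  rewrite mulr0 !sub0r mulrN opprK; have [->|_] := eqVneq x y; last by rewrite !mulr0.
  by rewrite mulr1 mulVf ?ac_neq0.
rewrite /T_kernel.
pose s := [seq a k | k <- iota 0 y.+1].
have sE w : (forall k, w != (a k)%:C) ->
    p 0 w / p y.+1 w * 1 = \prod_(b <- s) - (b%:C) * \prod_(b <- s) (w - b%:C)^-1.
  move=> wa; rewrite mulr1 {1}/p_poly big_ord0 mul1r /p_poly -prodfV -big_split /=.
  rewrite /s big_map -[iota 0 y.+1]/(index_iota 0 y.+1) big_mkord.
  apply: eq_bigr => k _; rewrite one_sub_div ?ac_neq0// invfM invrN invrK//.
rewrite (eq_contour (g := fun w => \prod_(b <- s) - (b%:C) * \prod_(b <- s) (w - b%:C)^-1));
  last by move=> t t01; rewrite sE// => k; exact: gamma_neq_a.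
have sa b : b \in s -> positively_encircles gamma (b%:C).
  by move=> /mapP[k _ ->]; exact: gamma_a.
have [y0|y0] := posnP y.
  rewrite {}y0 in s sE sa *; rewrite /s /= !big_seq1.
  rewrite (eq_contour (g := fun w => - (a 0%N)%:C * (w - (a 0%N)%:C)^-1)); last first.
    by move=> t _; rewrite big_seq1.
  have [_ W] := gamma_a 0; rewrite /winding_number in W.
  rewrite contourZ//; last first.
    apply: (@ccontV R `[0, 1]%classic (fun t => gamma t - (a 0%N)%:C)) => [t t01|].
      by rewrite subr_eq0 gamma_neq_a.
    by apply: ccontB; [exact: (con_curve_id gammaC1)|exact: ccont_cst].
  rewrite -[RHS]W; have := ac_neq0 0; have := two_pi_i_neq0 => h1 h2.
  by field; rewrite h1 h2.
rewrite contourZ//; last exact: con_inv_prod.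
rewrite contour_inv_prod//; last by rewrite /s size_map size_iota.
by rewrite !mulr0 ltn_eqF.
Qed.

(* The law after [n] steps, started from [x], of the chain which jumps from [y]
   to [y.+1] with probability [a y / c] and otherwise stays. *)
Fixpoint chain (c : R) n x y : R :=
  if n is n'.+1 then
    chain c n' x y * (1 - a y / c) + (if y is y'.+1 then a y' / c * chain c n' x y' else 0)
  else (x == y)%:R.

(** Splitting off one factor [1 - w / c] and applying [T_kernel_mulw] gives the forward equation of
    the chain. At [y = 0] there is no inflow because [J_integral] vanishes at index 0. *)
Lemma T_kernel_chain (c : R) n x y : 0 < c ->
  T_kernel a (fun w => (1 - w / c%:C) ^+ n) gamma x y = (chain c n x y)%:C.
Proof.
move=> c0; have cc0 : c%:C != 0 :> R[i] by rewrite eq_complex /= negb_and gt_eqF.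
have cg n' : con (fun w => (1 - w / c%:C) ^+ n').
  apply: ccontX; apply: ccontB; first exact: ccont_cst.
  by apply: ccontM; [exact: (con_curve_id gammaC1)|exact: ccont_cst].
have J0 n' : J_integral (fun w => (1 - w / c%:C) ^+ n') x 0 = 0.
  have := J_integral_poly ((1 - (c%:C)^-1 *: 'X) ^+ n') x; rewrite /J_integral => <-.
  by congr (_ * _); apply: eq_contour => t _; rewrite horner_exp !hornerE; congr (_ * (1 - _) ^+ _); rewrite mulrC.
elim: n y => [|n ih] y.
  transitivity ((x == y)%:R : R[i]); last by rewrite /=; case: (x == y).
  by rewrite -T_kernel1 /T_kernel; congr (_ * _); apply: eq_contour => t _; rewrite expr0.
transitivity (T_kernel a (fun w => (1 - w / c%:C) ^+ n -
    (c%:C)^-1 * (w * (1 - w / c%:C) ^+ n)) gamma x y).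
  by rewrite /T_kernel; congr (_ * _); apply: eq_contour => t _; rewrite exprS; ring.
rewrite T_kernelB//; last by apply: ccontM; [exact: ccont_cst|exact: (con_mulw (cg n))].
rewrite T_kernelZ; last exact: (con_mulw (cg n)).
rewrite T_kernel_mulw// J_integralE ih /=.
case: y => [|y]; first by rewrite J0 subr0 addr0 !rmorphM /= rmorphB /= rmorphM fmorphV; ring.
rewrite J_integralE ih !rmorphD /= !rmorphM /= rmorphB /= !rmorphM /= !fmorphV; ring.
Qed.

End TKernel.

(** * Mass and support of the chain *)

Section ChainBounds.
Context {R : realType}.
Variables (a : nat -> R) (c : R).
Hypotheses (a_ge0 : forall x, 0 <= a x) (a_le : forall x, a x <= c) (c0 : 0 < c).
Local Notation chain := (chain a c).

Lemma chain_ge0 n x y : 0 <= chain n x y.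
Proof.
elim: n y => [|n ih] y /=; first by rewrite ler0n.
rewrite addr_ge0//.
  by rewrite mulr_ge0// subr_ge0 ler_pdivrMr// mul1r.
by case: y => // y; rewrite mulr_ge0// divr_ge0// ltW.
Qed.

(** Mass leaves the states up to [m] only by the jump from [m] to [m.+1]. *)
Lemma sum_chainS n x m : \sum_(y < m.+1) chain n.+1 x y =
  \sum_(y < m.+1) chain n x y - a m / c * chain n x m.
Proof.
elim: m => [|m ih]; first by rewrite !big_ord1 /=; ring.
by rewrite big_ord_recr ih [in RHS]big_ord_recr /=; ring.
Qed.

Lemma chain_supp n x y : (x + n < y)%N -> chain n x y = 0.
Proof.
elim: n y => [|n ih] y /=; first by rewrite addn0 => /ltn_eqF ->.
rewrite addnS => xy; rewrite ih ?mul0r ?add0r; last exact: ltnW.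
by case: y xy => // y xy; rewrite ih// mulr0.
Qed.

Lemma sum_chain_le1 n x m : \sum_(y < m) chain n x y <= 1.
Proof.
case: m => [|m]; first by rewrite big_ord0.
elim: n => [|n ih].
  rewrite /=; have [xm|xm] := ltnP x m.+1.
    rewrite (bigD1 (Ordinal xm)) //= eqxx big1 ?addr0// => i.
    by rewrite -val_eqE /= eq_sym => /negbTE ->.
  by rewrite big1// => i _; rewrite gtn_eqF//; exact: leq_trans xm.
rewrite sum_chainS; apply: le_trans ih; rewrite gerBl.
by rewrite mulr_ge0 ?chain_ge0// divr_ge0// ltW.
Qed.

Lemma sum_chain_eq1 n x m : (x + n < m)%N -> \sum_(y < m) chain n x y = 1.
Proof.
elim: n m => [|n ih] m.
  rewrite addn0 => xm.
  rewrite (bigD1 (Ordinal xm)) //= eqxx big1 ?addr0// => i.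
  by rewrite -val_eqE /= eq_sym => /negbTE ->.
case: m => [|m]; first by rewrite ltn0.
rewrite addnS ltnS => xm; rewrite sum_chainS ih; last exact: ltnW.
by rewrite chain_supp// mulr0 subr0.
Qed.

End ChainBounds.

(** * Kernels of functions with a geometrically convergent expansion *)

Section ExpansionConsequences.
Context {R : realType}.
Variables (a : nat -> R) (gamma : R -> R[i]).
Hypothesis a_gt0 : forall x, 0 < a x.
Hypothesis gammaC1 : piecewise_C1 gamma.
Hypothesis gamma_closed : gamma 0 = gamma 1.
Hypothesis gamma_a : forall x, positively_encircles gamma ((a x)%:C).
Variables (f : R[i] -> R[i]) (c K s : R) (e : nat -> R[i]).
Hypothesis fc : con_curve gamma f.
Hypotheses (a_le : forall x, a x <= c) (K0 : 0 <= K) (s0 : 0 <= s) (s1 : s < 1).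
Hypothesis e_le : forall n, normc (e n) <= K * s ^+ n.
Local Notation partial N := (fun w : R[i] => \sum_(n < N) e n * (1 - w / c%:C) ^+ n).
Hypothesis f_curve : forall N t, t \in `[0, 1] ->
  normc (f (gamma t) - partial N (gamma t)) <= K * s ^+ N.
Hypothesis f_0 : forall N, normc (f 0 - \sum_(n < N) e n) <= K * s ^+ N.
Local Notation T := (T_kernel a f gamma).

Let c0 : 0 < c. Proof. exact: lt_le_trans (a_gt0 0) (a_le 0). Qed.
Let s1' : 0 < 1 - s. Proof. by rewrite subr_gt0. Qed.

Lemma con_pow n : con_curve gamma (fun w => (1 - w / c%:C) ^+ n).
Proof.
apply: ccontX; apply: ccontB; first exact: ccont_cst.
by apply: ccontM; [exact: (con_curve_id gammaC1)|exact: ccont_cst].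
Qed.

Lemma con_partial N : con_curve gamma (partial N).
Proof.
elim: N => [|N ih].
  by apply: eq_ccont (ccont_cst _ 0) => t _; rewrite big_ord0.
apply: eq_ccont (ccontD ih (ccontM (ccont_cst _ (e N)) (con_pow N))) => t _.
by rewrite big_ord_recr.
Qed.

Lemma partial_poly N : exists P : {poly R[i]}, forall w, P.[w] = partial N w.
Proof.
exists (\sum_(n < N) (e n)%:P * (1 - (c%:C)^-1 *: 'X) ^+ n) => w.
rewrite horner_sum; apply: eq_bigr => n _.
by rewrite hornerM hornerC horner_exp !hornerE; congr (_ * (1 - _) ^+ _); rewrite mulrC.
Qed.

(** Subtracting a partial sum of the expansion changes nothing, as partial sums are polynomials;
    what is left is small uniformly on the curve. *)
Lemma J_integral0 x : J_integral a gamma f x 0 = 0.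
Proof.
have [L L0 HL] := contour_bound gammaC1.
have [M M0 HM] := ccont_bounded ler01 (con_ratio a_gt0 gammaC1 gamma_a x 0).
apply/eqP; rewrite -normc_eq0 eq_le normc_ge0 andbT.
pose I := normc (- two_pi_i^-1 : R[i]).
apply: (@le0_geometric R _ (I * (L * (M * K))) s s0 s1) => N.
have -> : J_integral a gamma f x 0 =
    J_integral a gamma (fun w => f w - partial N.+1 w) x 0.
  have [P PE] := partial_poly N.+1.
  have := J_integral_poly a gammaC1 gamma_closed P x.
  rewrite /J_integral => P0; apply/eqP; rewrite -subr_eq0 -mulrBr; apply/eqP.
  rewrite -contourB//; last 2 first.
  - by apply: (con_Jintegrand a_gt0 gammaC1 gamma_a).
  - apply: (con_Jintegrand a_gt0 gammaC1 gamma_a); apply: ccontB => //.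
    exact: con_partial.
  rewrite -[RHS]P0; congr (_ * _); apply: eq_contour => t _; rewrite PE; ring.
rewrite /J_integral Normc.normcM -!mulrA ler_wpM2l ?normc_ge0//.
apply: HL; first by rewrite !mulr_ge0 ?exprn_ge0.
  apply: (con_Jintegrand a_gt0 gammaC1 gamma_a); apply: ccontB => //; exact: con_partial.
move=> t t01; rewrite Normc.normcM ler_pM ?normc_ge0//; first exact: HM.
exact: f_curve.
Qed.

Lemma T_kernel_approx x y : exists2 L : R, 0 <= L & forall N,
  normc (T x y - \sum_(n < N) e n * (chain a c n x y)%:C) <= L * s ^+ N.
Proof.
have [L L0 HL] := contour_bound gammaC1.
have [M M0 HM] := ccont_bounded ler01 (con_ratio a_gt0 gammaC1 gamma_a x y.+1).
pose I := normc (- two_pi_i^-1 * ((a y)%:C)^-1 : R[i]).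
exists (I * (L * (M * K))); first by rewrite !mulr_ge0 ?normc_ge0.
move=> N.
have -> : \sum_(n < N) e n * (chain a c n x y)%:C = T_kernel a (partial N) gamma x y.
  rewrite (T_kernel_sum a_gt0 gammaC1 gamma_a N e x y (F := fun n w => (1 - w / c%:C) ^+ n) con_pow).
  by apply: eq_bigr => n _; rewrite (T_kernel_chain a_gt0).
rewrite -(T_kernelB a_gt0 gammaC1 gamma_a)//; last exact: con_partial.
rewrite /T_kernel Normc.normcM -!mulrA ler_wpM2l ?normc_ge0//.
apply: HL; first by rewrite !mulr_ge0 ?exprn_ge0.
  apply: (con_Jintegrand a_gt0 gammaC1 gamma_a); apply: ccontB => //; exact: con_partial.
move=> t t01; rewrite Normc.normcM ler_pM ?normc_ge0//; first exact: HM.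
exact: f_curve.
Qed.

(** [L] may depend on [x] and [m]: afterwards [N] tends to infinity with these fixed, so [L]
    disappears and the resulting bounds do not contain it. *)
Lemma T_kernel_approx_unif x m : exists2 L : R, 0 <= L & forall N,
  \sum_(y < m) normc (T x y - \sum_(n < N) e n * (chain a c n x y)%:C) <= L * s ^+ N.
Proof.
elim: m => [|m [L L0 HL]].
  by exists 0 => // N; rewrite big_ord0 mul0r.
have [L' L'0 HL'] := T_kernel_approx x m.
exists (L + L'); first exact: addr_ge0.
by move=> N; rewrite big_ord_recr mulrDl lerD.
Qed.

Lemma sum_geometric_le N : \sum_(n < N) s ^+ n <= (1 - s)^-1.
Proof.
rewrite -[leRHS]mul1r ler_pdivlMr//.
have : \sum_(n < N) s ^+ n * (1 - s) = 1 - s ^+ N.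
  elim: N => [|N ih]; first by rewrite big_ord0 subrr.
  by rewrite big_ord_recr /= ih exprS; ring.
by rewrite mulr_suml => ->; rewrite gerBl exprn_ge0.
Qed.

Lemma le_geometric_limit (x y L : R) : (forall N, x <= y + L * s ^+ N) -> x <= y.
Proof.
move=> H; rewrite -subr_le0.
apply: (@le0_geometric R _ L s s0 s1) => N.
by rewrite lerBlDl.
Qed.

(** Each power of [1 - w / c] contributes a row of mass at most 1, so the total is at most the sum
    of the [normc (e n)], a geometric series. *)
Lemma T_kernel_summable x m : \sum_(y < m) normc (T x y) <= K / (1 - s).
Proof.
have [L L0 HL] := T_kernel_approx_unif x m.
apply: (@le_geometric_limit _ _ L) => N.
apply: le_trans (_ : _ <= \sum_(y < m) (normc (\sum_(n < N) e n * (chain a c n x y)%:C) +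
    normc (T x y - \sum_(n < N) e n * (chain a c n x y)%:C))) _.
  apply: ler_sum => y _; apply: le_trans (normcD _ _).
  by rewrite addrC subrK.
rewrite big_split /= lerD ?HL//.
have ch_ge0 := chain_ge0 (fun x => ltW (a_gt0 x)) a_le c0.
apply: le_trans (_ : _ <= \sum_(y < m) \sum_(n < N) normc (e n) * chain a c n x y) _.
  apply: ler_sum => y _; apply: le_trans (normc_sum _ _ _) _.
  by apply: ler_sum => n _; rewrite Normc.normcM normc_real ger0_norm.
rewrite exchange_big /=.
apply: le_trans (_ : _ <= \sum_(n < N) K * s ^+ n) _.
  apply: ler_sum => n _; rewrite -mulr_sumr -[leRHS]mulr1.
  apply: ler_pM; rewrite ?normc_ge0 ?sumr_ge0//.
  exact: (sum_chain_le1 (fun x => ltW (a_gt0 x)) a_le c0).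
by rewrite -mulr_sumr ler_wpM2l// sum_geometric_le.
Qed.

(** A chain started at [x] is still below [x + j] after [n < j] steps, so the first [j] terms of the
    expansion have full mass. The error comes from the geometric tail [n >= j]. *)
Lemma T_kernel_sum_f0 x j :
  normc (\sum_(y < x + j) T x y - f 0) <= K / (1 - s) * s ^+ j.
Proof.
have [L L0 HL] := T_kernel_approx_unif x (x + j).
apply: (@le_geometric_limit _ _ (L + K)) => N.
pose A y := \sum_(n < N) e n * (chain a c n x y)%:C.
(* Three errors: truncation of the expansion in the kernel, missing mass of the chain, and
   truncation of the expansion at 0. The first and last vanish as [N] grows. *)
have -> : \sum_(y < x + j) T x y - f 0 =
    \sum_(y < x + j) (T x y - A y) + (\sum_(y < x + j) A y - \sum_(n < N) e n) -
    (f 0 - \sum_(n < N) e n).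
  by rewrite sumrB addrA subrK opprB addrA subrK.
have H1 : normc (\sum_(y < x + j) (T x y - A y)) <= L * s ^+ N.
  exact: le_trans (normc_sum _ _ _) (HL N).
have H2 : normc (\sum_(y < x + j) A y - \sum_(n < N) e n) <= K / (1 - s) * s ^+ j.
  rewrite /A exchange_big /= -sumrB.
  have ch_ge0 := chain_ge0 (fun x => ltW (a_gt0 x)) a_le c0.
  apply: le_trans (_ : _ <= \sum_(n < N) K * (s ^+ n * (j <= n)%N%:R)) _.
    apply: le_trans (normc_sum _ _ _) _; apply: ler_sum => n _.
    rewrite -mulr_sumr -rmorph_sum /= -[X in _ - X]mulr1 -mulrBr Normc.normcM.
    rewrite -(rmorph1 (real_complex R)) -rmorphB normc_real.
    have [nj|jn] := ltnP n j.
      by rewrite sum_chain_eq1 ?ltn_add2l// subrr normr0 !mulr0.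
    rewrite mulr1 -[leRHS]mulr1 ler_pM ?normc_ge0//.
    rewrite ler0_norm ?subr_le0 ?opprB ?lerBlDr ?lerDl ?sumr_ge0//.
    exact: (sum_chain_le1 (fun x => ltW (a_gt0 x)) a_le c0).
  rewrite -mulr_sumr -mulrA ler_wpM2l// mulrC ler_pdivlMr// mulr_suml.
  (* The [maxn] also covers [N <= j], where the truncated tail is empty. *)
  have : \sum_(n < N) s ^+ n * (j <= n)%N%:R * (1 - s) + s ^+ maxn j N = s ^+ j.
    elim: (N) => [|M ih]; first by rewrite big_ord0 add0r maxn0.
    rewrite big_ord_recr /= -[RHS]ih -addrA; congr (_ + _).
    have [jM|Mj] := leqP j M.
      by rewrite (maxn_idPr (leqW jM)) exprS mulr1; ring.
    by rewrite (maxn_idPl Mj) mulr0 mul0r add0r.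
  by move=> <-; rewrite lerDl exprn_ge0.
have := normcD (\sum_(y < x + j) (T x y - A y) + (\sum_(y < x + j) A y - \sum_(n < N) e n))
  (- (f 0 - \sum_(n < N) e n)).
have := normcD (\sum_(y < x + j) (T x y - A y)) (\sum_(y < x + j) A y - \sum_(n < N) e n).
rewrite normcN mulrDl => h1 h2; apply: le_trans h2 _; rewrite [leRHS]addrA.
apply: lerD; last exact: f_0.
by apply: le_trans h1 _; rewrite [leRHS]addrC lerD.
Qed.

End ExpansionConsequences.

(** * From holomorphy to the properties of the kernel *)

Section TKernelHolomorphic.
Context {R : realType}.
Variables (a : nat -> R) (gamma : R -> R[i]) (eps M : R) (f : R[i] -> R[i]).
Hypothesis a_gt0 : forall x, 0 < a x.
Hypothesis a_leM : forall x, a x <= M.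
Hypothesis gammaC1 : piecewise_C1 gamma.
Hypothesis gamma_closed : gamma 0 = gamma 1.
Hypothesis gamma_a : forall x, positively_encircles gamma ((a x)%:C).
Hypothesis gamma_sub : curve_image gamma `<=` right_half_plane eps.
Hypothesis eps_gt0 : 0 < eps.
Hypothesis f_holo : holomorphic_on (right_half_plane eps) f.

Lemma holomorphic_con_curve : con_curve gamma f.
Proof.
apply: (ccont_comp (f := f) (con_curve_id gammaC1)) => t t01.
have /derivable_cderivable[l] := f_holo (gamma_sub (ex_intro2 _ _ t t01 erefl)).
exact: cderivable_ccontinuous.
Qed.

(* A disc centred at [c] of radius slightly larger than [c] exhausts the half
   plane as [c] grows; [c] is taken so large that the disc contains the curve. *)
Lemma enclosing_disc : exists c rho r : R,
  [/\ forall x, a x <= c, 0 < c, c <= rho, rho < r & r < c + eps] /\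
  forall t, t \in `[0, 1] -> normc (gamma t - c%:C) <= rho.
Proof.
have [cg1 cg2] := con_curve_id gammaC1.
have [t0 t01 tmin] := EVT_min ler01 cg1.
have [B B0 HB] := ccont_bounded ler01 (conj cg1 cg2).
have Ht0 : - eps < Re (gamma t0) by apply: gamma_sub; exists t0.
(* How far the curve reaches into the left half plane. The gap between [e1] and [eps] is divided
   into three steps of size [h], which separate [c + e1], [rho], [r] and [c + eps]. *)
pose e1 := Num.max 0 (- Re (gamma t0)).
have e1_ge0 : 0 <= e1 by rewrite /e1 le_max lexx.
have e1_lt : e1 < eps by rewrite /e1 gt_max eps_gt0 ltrNl.
have e1P t : t \in `[0, 1] -> - e1 <= Re (gamma t).
  by move=> /tmin H; rewrite lerNl; apply: le_trans (_ : - Re (gamma t0) <= _);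
    rewrite ?lerN2// /e1 le_max lexx orbT.
pose h := (eps - e1) / 3.
have h0 : 0 < h by rewrite divr_gt0// subr_gt0.
(* [M] dominates all [a x]; [B] puts the curve to the left of the centre; the last term makes the
   squared imaginary part at most [2 * h * c], the cross term gained when [c + e1] is enlarged by
   [h]. *)
pose c := Num.max (Num.max M B) (B ^+ 2 / (2 * h)).
have cM : M <= c by rewrite /c !le_max lexx.
have cB : B <= c by rewrite /c !le_max lexx orbT.
have ch : B ^+ 2 <= 2 * h * c.
  rewrite [leRHS]mulrC -ler_pdivrMr; last by rewrite mulr_gt0.
  by rewrite /c !le_max lexx orbT.
have c0 : 0 < c by apply: lt_le_trans cM; exact: lt_le_trans (a_gt0 0) (a_leM 0).
exists c, (c + e1 + h), (c + e1 + 2 * h); split.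
  have eh : eps = e1 + 3 * h by rewrite /h; field.
  by split; [move=> x; exact: le_trans cM|by []|lra|lra|lra].
move=> t t01'; rewrite -[leLHS]ger0_norm ?normc_ge0//; apply: sqr_le_norm; first by lra.
rewrite normc_sqr ReB ImB /= subr0.
have g1 := e1P _ t01'.
have g2 : Re (gamma t) <= B by apply: le_trans (HB _ t01'); apply: le_trans (Re_le_normc _); exact: ler_norm.
have g3 : Im (gamma t) ^+ 2 <= B ^+ 2.
  rewrite -real_normK ?num_real// lerXn2r ?nnegrE//.
  by apply: le_trans (HB _ t01'); exact: Im_le_normc.
have g4 : (Re (gamma t) - c) ^+ 2 <= (c + e1) ^+ 2.
  by rewrite -sqrrN opprB lerXn2r ?nnegrE; lra.
apply: le_trans (lerD g4 (le_trans g3 ch)) _.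
have -> : (c + e1 + h) ^+ 2 = (c + e1) ^+ 2 + 2 * h * c + (2 * h * e1 + h ^+ 2) by ring.
by rewrite lerDl addr_ge0 ?sqr_ge0// mulr_ge0// mulr_ge0// ltW.
Qed.

Theorem T_kernel_stochastic : exists K s : R, [/\ 0 <= K, 0 <= s < 1,
  forall x, J_integral a gamma f x 0 = 0,
  forall x m, \sum_(y < m) normc (T_kernel a f gamma x y) <= K &
  forall x j, normc (\sum_(y < x + j) T_kernel a f gamma x y - f 0) <= K * s ^+ j].
Proof.
have [c [rho [r [[a_le c0 crho rhor reps] gd]]]] := enclosing_disc.
have r0 : 0 < r by lra.
have rho0 : 0 <= rho by lra.
have fr w : rectangle (c - r) (c + r) (- r) r w -> derivable (f : R[i]^o -> R[i]^o) w 1.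
  by move=> [/andP[w1 _] _]; apply: f_holo; rewrite /right_half_plane /=; lra.
have [K K0 [d dK dP]] := disc_expansion r0 rho0 rhor fr.
pose s := rho / r.
have s0 : 0 <= s by rewrite divr_ge0// ltW.
have s1 : s < 1 by rewrite ltr_pdivrMr// mul1r.
(* Rescaling from powers of [z - c] to powers of [1 - z / c]. The factor of modulus [c ^+ n] is
   absorbed because [c <= rho]. *)
pose e n := d n * (- c%:C) ^+ n.
have cc0 : c%:C != 0 :> R[i] by rewrite eq_complex /= negb_and gt_eqF.
have e_le n : normc (e n) <= K * s ^+ n.
  rewrite /e Normc.normcM normcX normcN normc_real gtr0_norm//.
  apply: le_trans (_ : _ <= K / r ^+ n * rho ^+ n) _; last first.
    by rewrite /s expr_div_n mulrA mulrAC.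
  by apply: ler_pM; rewrite ?normc_ge0 ?exprn_ge0 ?(ltW c0)// lerXn2r ?nnegrE// ltW.
have pE N z : \sum_(n < N) d n * (z - c%:C) ^+ n = \sum_(n < N) e n * (1 - z / c%:C) ^+ n.
  apply: eq_bigr => n _; rewrite /e -mulrA -exprMn; congr (_ * _ ^+ _).
  by field.
have f_curve N t : t \in `[0, 1] ->
    normc (f (gamma t) - \sum_(n < N) e n * (1 - gamma t / c%:C) ^+ n) <= K * s ^+ N.
  by move=> t01; rewrite -pE; apply: dP; exact: gd.
have f_0 N : normc (f 0 - \sum_(n < N) e n) <= K * s ^+ N.
  have <- : \sum_(n < N) e n * (1 - 0 / c%:C) ^+ n = \sum_(n < N) e n.
    by apply: eq_bigr => n _; rewrite mul0r subr0 expr1n mulr1.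
  by rewrite -pE; apply: dP; rewrite sub0r normcN normc_real gtr0_norm.
have fc := holomorphic_con_curve.
exists (K / (1 - s)), s; split.
- by rewrite divr_ge0// subr_ge0 ltW.
- by rewrite s0.
- exact: (J_integral0 a_gt0 gammaC1 gamma_closed gamma_a fc K0 s0 s1 f_curve).
- exact: (T_kernel_summable a_gt0 gammaC1 gamma_closed gamma_a fc a_le K0 s0 s1 e_le f_curve).
- exact: (T_kernel_sum_f0 a_gt0 gammaC1 gamma_closed gamma_a fc a_le K0 s0 s1 e_le f_curve f_0).
Qed.

End TKernelHolomorphic.

(** * Unordered sums *)

Section UnorderedSums.
Context {R : realType} {I : choiceType}.
Implicit Types (F : I -> R[i]) (s t : seq I).

Lemma sum_restrict (V : nmodType) (F : I -> V) s t : uniq s -> uniq t ->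
  (forall i, i \in s -> F i != 0 -> i \in t) ->
  \sum_(i <- s) F i = \sum_(i <- t | i \in s) F i.
Proof.
move=> us ut st; rewrite (bigID (mem t)) /= [X in _ + X]big1_seq ?addr0.
  rewrite -big_filter -[RHS]big_filter; apply/perm_big/uniq_perm.
  - exact: filter_uniq.
  - exact: filter_uniq.
  - by move=> i; rewrite !mem_filter andbC.
move=> i /andP[it is_]; apply/eqP; apply: contraNT it => /(st _ is_).
by [].
Qed.

Definition ctends (u : nat -> R[i]) (l : R[i]) := forall e : R, 0 < e ->
  exists n0 : nat, forall n, (n0 <= n)%N -> normc (u n - l) < e.

Variables (F : I -> R[i]) (A : nat -> seq I) (B : R) (S : R[i]).
Hypothesis A_uniq : forall n, uniq (A n).
Hypothesis A_sub : forall n m, (n <= m)%N -> {subset A n <= A m}.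
Hypothesis A_supp : forall i, F i != 0 -> exists n, i \in A n.
Hypothesis A_bound : forall n, \sum_(i <- A n) normc (F i) <= B.
Hypothesis A_lim : ctends (fun n => \sum_(i <- A n) F i) S.

Lemma finite_supp s n0 : exists2 m, (n0 <= m)%N &
  forall i, i \in s -> F i != 0 -> i \in A m.
Proof.
elim: s => [|i s [m nm ih]]; first by exists n0.
have [Fi0|/A_supp[m' im']] := eqVneq (F i) 0.
  by exists m => // j; rewrite inE => /predU1P[->|/ih//]; rewrite Fi0 eqxx.
exists (maxn m m'); first exact: leq_trans nm (leq_maxl _ _).
move=> j; rewrite inE => /predU1P[-> _|/ih H /H].
  exact: A_sub (leq_maxr _ _) _ im'.
exact: A_sub (leq_maxl _ _) j.
Qed.

Lemma partial_norm_bound s : uniq s -> \sum_(i <- s) normc (F i) <= B.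
Proof.
move=> us; have [m _ sm] := finite_supp s 0.
rewrite (sum_restrict us (A_uniq m)); last first.
  by move=> i is_ nF; apply: sm => //; rewrite -normc_eq0.
apply: le_trans (A_bound m); rewrite big_mkcond /=; apply: ler_sum => i _.
by case: ifP => _; rewrite ?lexx ?normc_ge0.
Qed.

Lemma summable_exhaustion : summable [set: I] (fun i => (normc (F i))%:E).
Proof.
apply: le_lt_trans (ltry B); apply: ge_ereal_sup => _ [X [finX _] <-].
rewrite fsbig_finite//=.
rewrite (eq_bigr (fun i => (normc (F i))%:E)); last first.
  by move=> i _; rewrite ger0_norm ?normc_ge0.
by rewrite sumEFin lee_fin; apply: partial_norm_bound; exact: fset_uniq.
Qed.

(** The partial sums of norms increase and are bounded, so beyond an index where they come within
    [e] of their supremum little can be added. *)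
Lemma tail_small (e : R) : 0 < e -> exists n0, forall n m, (n0 <= n)%N -> (n <= m)%N ->
  \sum_(i <- A m | i \notin A n) normc (F i) < e.
Proof.
move=> e0; pose b n := \sum_(i <- A n) normc (F i).
have sup_b : has_sup (range b).
  by split; [exists (b 0%N), 0%N|exists B => _ [n _ <-]; exact: A_bound].
have [_ [n0 _ <-] bn0] := sup_adherent e0 sup_b.
have bE n m : (n <= m)%N -> b m = b n + \sum_(i <- A m | i \notin A n) normc (F i).
  move=> nm; rewrite /b [LHS](bigID (fun i => i \in A n)) /=; congr (_ + _).
  by rewrite -sum_restrict// => i /(A_sub nm).
exists n0 => n m n0n nm.
have b_le : b m <= sup (range b) by apply: ub_le_sup; [case: sup_b|exists m].
have := bE _ _ nm; have := bE _ _ n0n.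
have : 0 <= \sum_(i <- A n | i \notin A n0) normc (F i).
  by apply: sumr_ge0 => i _; exact: normc_ge0.
by move: bn0 b_le; lra.
Qed.

(** Absolute summability makes the limit along the single exhaustion [A] the limit over the directed
    family of all finite sets, which is how [summability.sum] is defined. *)
Lemma sum_exhaustion : summability.sum (F : I -> R[i]^o) = S.
Proof.
have FF : ProperFilter (@summability.totally I) := summability.totally_filter.
rewrite /summability.sum; apply: cvg_lim; first exact: norm_hausdorff.
apply/cvgrPdist_lt => e e0.
have eE : e = (Re e)%:C by rewrite RRe_real// gtr0_real.
have e0' : 0 < Re e by move: e0; rewrite eE ltcR.
have e20 : 0 < Re e / 2 by rewrite divr_gt0.
have [n1 H1] := A_lim e20; have [n2 H2] := tail_small e20.
pose n := maxn n1 n2.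
exists [fset i in A n]%fset => // J /= AJ.
have {}AJ i : i \in A n -> i \in J by move=> iA; apply: (fsubsetP AJ); rewrite inE.
(* Up to zeros of [F], the finite set [J] lies in some [A m], so it differs from [A n] by part of a
   small tail. *)
have [m nm Jm] := finite_supp J n.
have -> : summability.partial_sum (F : I -> R[i]^o) J = \sum_(i <- A m | i \in J) F i.
  rewrite /summability.partial_sum -(big_seq_fsetE _ J xpredT F) /=.
  exact: (sum_restrict (fset_uniq J) (A_uniq m)).
have E z : `|z : R[i]^o| = (normc z)%:C by case: z.
rewrite E eE ltcR.
have -> : S - \sum_(i <- A m | i \in J) F i =
    - (\sum_(i <- A n) F i - S) - \sum_(i <- A m | (i \in J) && (i \notin A n)) F i.
  rewrite (bigID (fun i => i \in A n)) /= opprD addrA; congr (_ - _).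
  rewrite opprB; congr (_ - _).
  rewrite (sum_restrict (A_uniq n) (A_uniq m)); last first.
    by move=> i iA _; exact: A_sub nm _ iA.
  by apply: eq_bigl => i; case iA: (i \in A n); rewrite ?andbF// andbT AJ.
apply: le_lt_trans (normcD _ _) _; rewrite !normcN [ltRHS]splitr.
apply: ltrD; first by apply: H1; exact: leq_maxl.
apply: le_lt_trans (normc_sum _ _ _) _.
apply: le_lt_trans (H2 n m (leq_maxr _ _) nm).
rewrite big_mkcond [leRHS]big_mkcond /=; apply: ler_sum => i _.
by case: (i \in J); case: (i \notin A n); rewrite /= ?lexx ?normc_ge0.
Qed.

End UnorderedSums.

Section FiniteUnorderedSum.
Context {R : realType} {I : choiceType}.

Lemma finite_unordered_sum (F : I -> R[i]) s : uniq s ->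
  (forall i, F i != 0 -> i \in s) ->
  summable [set: I] (fun i => (normc (F i))%:E) /\
  summability.sum (F : I -> R[i]^o) = \sum_(i <- s) F i.
Proof.
move=> us Fs.
have u' (n : nat) : uniq s by [].
have sub (n m : nat) : (n <= m)%N -> {subset s <= s} by move=> _ i.
have supp i : F i != 0 -> exists n : nat, i \in s by move=> /Fs; exists 0%N.
have bnd (n : nat) : \sum_(i <- s) normc (F i) <= \sum_(i <- s) normc (F i) by [].
split; first exact: (summable_exhaustion u' sub supp bnd).
apply: (sum_exhaustion u' sub supp bnd) => e e0.
by exists 0%N => n _; rewrite subrr Normc.normc0.
Qed.

End FiniteUnorderedSum.

(** * Determinants and the intertwining relation *)

Section WeylChamberEnumeration.

Definition W_tuple m n (u : {ffun 'I_m -> 'I_n}) : m.-tuple nat := [tuple (u i : nat) | i < m].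

(** These finite sets exhaust [W m]. Building them from maps ['I_m -> 'I_n] matches the index set
    produced by multilinearity of the determinant. *)
Definition W_upto m n : seq (W m) :=
  pmap insub [seq W_tuple u | u <- enum {ffun 'I_m -> 'I_n}].

Lemma W_upto_uniq m n : uniq (W_upto m n).
Proof.
apply: pmap_sub_uniq; rewrite map_inj_uniq ?enum_uniq// => u v uv.
apply/ffunP => i; apply: val_inj.
by have := congr1 (fun t => tnth t i) uv; rewrite !tnth_mktuple.
Qed.

Lemma mem_W_upto m n (z : W m) : (z \in W_upto m n) = [forall i, wcoord z i < n]%N.
Proof.
rewrite /W_upto mem_pmap_sub; apply/mapP/forallP => [[u _ E] i|H].
  by rewrite /wcoord E tnth_mktuple.
exists [ffun i => Ordinal (H i)]; first by rewrite mem_enum.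
apply: eq_from_tnth => i.
by rewrite tnth_mktuple ffunE.
Qed.

Lemma W_upto_sub m n n' : (n <= n')%N -> {subset W_upto m n <= W_upto m n'}.
Proof.
move=> nn' z; rewrite !mem_W_upto => /forallP H; apply/forallP => i.
exact: leq_trans (H i) nn'.
Qed.

Lemma W_upto_supp m (z : W m) : exists n, z \in W_upto m n.
Proof.
exists (\max_(i < m) wcoord z i).+1; rewrite mem_W_upto; apply/forallP => i.
by rewrite ltnS (leq_bigmax i).
Qed.

Lemma wcoord_lt m (z : W m) (i j : 'I_m) : (i < j)%N -> (wcoord z i < wcoord z j)%N.
Proof.
case: z => t st ij; rewrite /wcoord /= !(tnth_nth 0%N).
rewrite (sorted_ltn_nth ltn_trans 0%N st) ?inE ?size_tuple ?ltn_ord//.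
Qed.

(** The coordinatewise constraints already force the values to increase, so passing from all maps to
    ordered configurations loses no term. *)
Lemma sum_W_upto (V : nmodType) m n (Q : 'I_m -> pred nat) (G : ('I_m -> nat) -> V) :
  (forall h : 'I_m -> nat, (forall i, Q i (h i)) ->
     forall i j : 'I_m, (i < j)%N -> (h i < h j)%N) ->
  \sum_(z <- W_upto m n | [forall i, Q i (wcoord z i)]) G (wcoord z) =
  \sum_(u : {ffun 'I_m -> 'I_n} | [forall i, Q i (u i)]) G (fun i => u i).
Proof.
move=> Qs; rewrite /W_upto big_mkcond big_pmap big_map big_enum /= [RHS]big_mkcond /=.
apply: eq_bigr => u _.
have E i : tnth (W_tuple u) i = u i by rewrite tnth_mktuple.
case: insubP => [z zs zE|ns] /=.
  have zu : wcoord z = (fun i => u i) by apply/funext => i; rewrite /wcoord zE E.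
  by rewrite zu.
case: ifP => // /forallP H; case/negP: ns.
apply/(sortedP 0%N) => i; rewrite size_tuple => im.
have im' : (i < m)%N by exact: ltnW.
have := Qs _ H (Ordinal im') (Ordinal im) (ltnSn i).
by rewrite -!E !(tnth_nth 0%N).
Qed.

End WeylChamberEnumeration.

(** * Determinant identities *)

Section DeterminantExpansion.
Context {R : comNzRingType}.

Lemma det_sum_rows m n (Q : 'I_m -> pred 'I_n) (g : 'I_m -> 'I_n -> 'I_m -> R) :
  \det (\matrix_(i, j) \sum_(v < n | Q i v) g i v j) =
  \sum_(u : {ffun 'I_m -> 'I_n} | [forall i, Q i (u i)]) \det (\matrix_(i, j) g i (u i) j).
Proof.
rewrite /determinant exchange_big /=; apply: eq_bigr => s _.
rewrite -mulr_sumr; congr (_ * _).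
rewrite (eq_bigr (fun i => \sum_(v < n | Q i v) g i v (s i))); last by move=> i _; rewrite mxE.
rewrite bigA_distr_big_dep /=; apply: eq_big => u; last first.
  by move=> _; apply: eq_bigr => i _; rewrite mxE.
by apply/familyP/forallP => H i; have := H i.
Qed.

Lemma det_sum_cols m n (Q : 'I_m -> pred 'I_n) (g : 'I_m -> 'I_n -> R) :
  \det (\matrix_(i, j) \sum_(v < n | Q j v) g i v) =
  \sum_(u : {ffun 'I_m -> 'I_n} | [forall i, Q i (u i)]) \det (\matrix_(i, j) g i (u j)).
Proof.
rewrite -det_tr (_ : _^T = \matrix_(i, j) \sum_(v < n | Q i v) g j v); last first.
  by apply/matrixP => i j; rewrite !mxE.
rewrite (det_sum_rows Q (fun i v j => g j v)); apply: eq_bigr => u _.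
by rewrite -det_tr; congr (\det _); apply/matrixP => i j; rewrite !mxE.
Qed.

Lemma det_col_differences n (C M : 'M[R]_n.+1) :
  (forall i, M i ord0 = C i ord0) ->
  (forall i (j : 'I_n), M i (lift ord0 j) = C i (lift ord0 j) - C i (widen_ord (leqnSn n) j)) ->
  \det M = \det C.
Proof.
move=> M0 MS.
pose B : 'M[R]_n.+1 := \matrix_(k, j) ((k == j)%:R - (k.+1 == j :> nat)%:R).
have -> : M = C *m B.
  apply/matrixP => i j; rewrite mxE.
  under eq_bigr do rewrite mxE mulrBr.
  rewrite sumrB (bigD1 j) //= eqxx mulr1 [X in _ + X - _]big1 ?addr0; last first.
    by move=> k /negbTE ->; rewrite mulr0.
  case: (unliftP ord0 j) => [j'|] ->.
    rewrite MS (bigD1 (widen_ord (leqnSn n) j')) //= eqxx mulr1 big1 ?addr0//.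
    move=> k kj; rewrite [_ == _](_ : _ = false) ?mulr0//.
    by apply: contraNF kj => /eqP[kj]; apply/eqP/val_inj.
  by rewrite M0 big1 ?subr0// => k _; rewrite mulr0.
rewrite det_mulmx -[\det B]det_tr [\det B^T]det_trig.
  by rewrite big1 ?mulr1// => i _; rewrite !mxE eqxx gtn_eqF ?subr0.
apply/is_trig_mxP => i j ij; rewrite !mxE -val_eqE /= gtn_eqF// gtn_eqF ?subrr//.
exact: ltnW.
Qed.

(** Subtracting from each row its predecessor turns the last column into 1 followed by zeros. The
    sign is that of the cofactor in the top right corner. *)
Lemma det_row_differences n (C : 'M[R]_n.+1) : (forall i, C i ord_max = 1) ->
  \det C = (-1) ^+ n *
    \det (\matrix_(i < n, j < n) (C (lift ord0 i) (widen_ord (leqnSn n) j) -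
                                  C (widen_ord (leqnSn n) i) (widen_ord (leqnSn n) j))).
Proof.
move=> C1.
pose M : 'M[R]_n.+1 := \matrix_(i, j)
  (C i j - (if unlift ord0 i is Some i' then C (widen_ord (leqnSn n) i') j else 0)).
have -> : \det C = \det M.
  rewrite -det_tr -[RHS]det_tr; apply/esym; apply: det_col_differences => i.
    by rewrite !mxE unlift_none subr0.
  by move=> j; rewrite !mxE liftK.
rewrite (expand_det_col M ord_max) (bigD1 ord0) //= big1 ?addr0; last first.
  move=> i i0; rewrite mxE; case: (unliftP ord0 i) i0 => [i'|] -> //.
  by move=> _; rewrite !C1 subrr mul0r.
rewrite mxE unlift_none subr0 C1 mul1r /cofactor add0n; congr (_ * \det _).
apply/matrixP => i j; rewrite !mxE liftK.
by have -> : lift ord_max j = widen_ord (leqnSn n) j by apply: ord_inj; rewrite lift_max.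
Qed.

Lemma expand_det_last_col n (C : 'M[R]_n.+1) (v : 'I_n.+1 -> R) :
  (forall i, C i ord_max = v i) ->
  \det C = \sum_i v i * cofactor C i ord_max.
Proof. by move=> Cv; rewrite (expand_det_col C ord_max); apply: eq_bigr => i _; rewrite Cv. Qed.

End DeterminantExpansion.

(** * Limits of complex sequences *)

Section Limits.
Context {R : realType}.
Implicit Types (u v : nat -> R[i]) (l m c : R[i]).

Lemma ctendsD u v l m : ctends u l -> ctends v m -> ctends (fun n => u n + v n) (l + m).
Proof.
move=> ul vm e e0; have e20 : 0 < e / 2 by rewrite divr_gt0.
have [n1 H1] := ul _ e20; have [n2 H2] := vm _ e20.
exists (maxn n1 n2) => n; rewrite geq_max => /andP[/H1 h1 /H2 h2].
have -> : u n + v n - (l + m) = (u n - l) + (v n - m) by ring.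
by apply: le_lt_trans (normcD _ _) _; rewrite [ltRHS]splitr ltrD.
Qed.

Lemma ctendsZ c u l : ctends u l -> ctends (fun n => c * u n) (c * l).
Proof.
move=> ul e e0; have c0 : 0 < normc c + 1 by rewrite ltr_wpDl ?normc_ge0.
have [n0 H] := ul _ (divr_gt0 e0 c0); exists n0 => n /H h.
rewrite -mulrBr Normc.normcM.
apply: le_lt_trans (_ : _ <= (normc c + 1) * normc (u n - l)) _.
  by rewrite ler_wpM2r ?normc_ge0// lerDl.
by rewrite mulrC -ltr_pdivlMr.
Qed.

Lemma ctends_sum (I : Type) (r : seq I) (u : I -> nat -> R[i]) (l : I -> R[i]) :
  (forall i, ctends (u i) (l i)) ->
  ctends (fun n => \sum_(i <- r) u i n) (\sum_(i <- r) l i).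
Proof.
move=> ul; elim: r => [|i r ih].
  by move=> e e0; exists 0%N => n _; rewrite !big_nil subrr Normc.normc0.
move=> e /(ctendsD (ul i) ih)[n0 H]; exists n0 => n /H.
by rewrite !big_cons.
Qed.

Lemma ctends_eventually u v l n0 : (forall n, (n0 <= n)%N -> u n = v n) ->
  ctends u l -> ctends v l.
Proof.
move=> uv ul e /ul[n1 H]; exists (maxn n0 n1) => n; rewrite geq_max => /andP[/uv <- /H].
by [].
Qed.

End Limits.

(** * Norm bounds for sums of determinants *)

Section KernelSums.
Context {R : realType}.

Lemma det_norm_le m (A : 'M[R[i]]_m) :
  normc (\det A) <= \sum_(s : 'S_m) \prod_i normc (A i (s i)).
Proof.
rewrite /determinant; apply: le_trans (normc_sum _ _ _) _; apply: ler_sum => s _.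
rewrite Normc.normcM normc_prod normcX normcN Normc.normc1 expr1n mul1r.
by [].
Qed.

Lemma sum_W_upto_le m n (G : ('I_m -> nat) -> R) : (forall h, 0 <= G h) ->
  \sum_(z <- W_upto m n) G (wcoord z) <=
  \sum_(u : {ffun 'I_m -> 'I_n}) G (fun i => u i).
Proof.
move=> G0; rewrite /W_upto big_pmap big_map big_enum /=.
apply: ler_sum => u _; case: insubP => [z zs zE|ns] /=; last exact: G0.
by have -> : wcoord z = (fun i => u i)
  by apply/funext => i; rewrite /wcoord zE tnth_mktuple.
Qed.

(** Once the ordering of the coordinates is dropped, each term of the Leibniz formula sums to a
    product of [m] row sums, each at most [K]; the bound is uniform in [n]. *)
Lemma sum_det_norm_le m n (T : nat -> nat -> R[i]) (y : 'I_m -> nat) (K : R) : 0 <= K ->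
  (forall x k, \sum_(v < k) normc (T x v) <= K) ->
  \sum_(z <- W_upto m n) normc (\det (\matrix_(i < m, j < m) T (y i) (wcoord z j))) <=
  \sum_(s : 'S_m) K ^+ m.
Proof.
move=> K0 TK.
pose G (h : 'I_m -> nat) := \sum_(s : 'S_m) \prod_i normc (T (y i) (h (s i))).
have G0 h : 0 <= G h by apply: sumr_ge0 => s _; apply: prodr_ge0 => i _; exact: normc_ge0.
apply: le_trans (_ : _ <= \sum_(z <- W_upto m n) G (wcoord z)) _.
  apply: ler_sum => z _; apply: le_trans (det_norm_le _) _.
  by apply: ler_sum => s _; rewrite le_eqVlt; apply/orP; left; apply/eqP;
    apply: eq_bigr => i _; rewrite mxE.
apply: le_trans (sum_W_upto_le n G0) _; rewrite /G exchange_big /=.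
apply: ler_sum => s _.
(* Reindexing by the permutation makes the [j]-th factor depend on [u j] alone, as exchanging sum
   and product requires. *)
rewrite (eq_bigr (fun u : {ffun 'I_m -> 'I_n} =>
    \prod_j normc (T (y ((s^-1)%g j)) (u j)))); last first.
  move=> u _; rewrite [RHS](reindex_inj (@perm.perm_inj _ s)) /=.
  by apply: eq_bigr => i _; rewrite perm.permK.
rewrite -(bigA_distr_bigA (fun j (v : 'I_n) => normc (T (y ((s^-1)%g j)) v))) /=.
apply: le_trans (_ : _ <= \prod_(j < m) K) _.
  apply: ler_prod => j _; rewrite TK andbT.
  by apply: sumr_ge0 => v _; exact: normc_ge0.
by rewrite prodr_const card_ord.
Qed.

End KernelSums.

(** * The intertwining relation at a fixed pair of configurations *)

Section Intertwining.
Context {R : realType}.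
Variables (a : nat -> R) (gamma : R -> R[i]) (f : R[i] -> R[i]) (K s : R).
Local Notation T := (T_kernel a f gamma).
Hypothesis a_gt0 : forall x, 0 < a x.
Hypotheses (K0 : 0 <= K) (s0 : 0 <= s) (s1 : s < 1).
Hypothesis T_summable : forall x m, \sum_(y < m) normc (T x y) <= K.
Hypothesis T_sum1 : forall x j, normc (\sum_(y < x + j) T x y - 1) <= K * s ^+ j.
Hypothesis T_row_sum : forall x m,
  \sum_(z < m.+1) T x.+1 z - \sum_(z < m.+1) T x z = - ((a m)%:C / (a x)%:C * T x m).
Variables (N : nat) (y : W N.+1) (x : W N).

Local Notation ac v := ((a v)%:C : R[i]).
Local Notation widen := (widen_ord (leqnSn N)).

Let a0 v : ac v != 0. Proof. by rewrite eq_complex /= negb_and gt_eqF. Qed.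

Lemma lift_max_widen (j : 'I_N) : lift ord_max j = widen j.
Proof. by apply: ord_inj; rewrite lift_max. Qed.

Lemma T_sum_ctends i : ctends (fun n => \sum_(v < n) T i v) 1.
Proof.
move=> e e0.
have := @cvg_geometric R K s; rewrite ger0_norm// => /(_ s1)/cvgrPdist_lt/(_ _ e0)[n0 _ H].
exists (i + n0)%N => n in_; rewrite -(subnKC (leq_trans (leq_addr n0 i) in_)) /=.
apply: le_lt_trans (T_sum1 _ _) _.
have := H (n - i)%N; rewrite /= leq_subRL ?(leq_trans (leq_addr n0 i))// => /(_ in_).
by rewrite /geometric /= sub0r normrN => /(le_lt_trans (ler_norm _)).
Qed.

(* [slot j v]: the value [v] is allowed for the [j]-th coordinate of a configuration
   interlacing with [x]; there is no upper bound for the last one. *)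
Definition le_bound (j : 'I_N.+1) (v : nat) : bool :=
  if unlift ord_max j is Some i then (v <= wcoord x i)%N else true.
Definition gt_bound (j : 'I_N.+1) (v : nat) : bool :=
  if unlift ord0 j is Some i then (wcoord x i < v)%N else true.
Definition slot j v := le_bound j v && gt_bound j v.

Lemma interlace_slot (z : W N.+1) : interlace x z = [forall j, slot j (wcoord z j)].
Proof.
apply/forallP/forallP => H => [j|i].
  apply/andP; split; rewrite /le_bound /gt_bound.
    case: unliftP => [i ->|//]; rewrite lift_max_widen.
    by have /andP[] := H i.
  case: unliftP => [i ->|//].
  by have /andP[] := H i.
apply/andP; split.
  by have /andP[+ _] := H (widen i); rewrite /le_bound -lift_max_widen liftK.
by have /andP[_] := H (lift ord0 i); rewrite /gt_bound liftK.
Qed.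

Lemma slot_increasing (h : 'I_N.+1 -> nat) : (forall j, slot j (h j)) ->
  forall i j : 'I_N.+1, (i < j)%N -> (h i < h j)%N.
Proof.
move=> H i j ij.
have /andP[+ _] := H i; have /andP[_] := H j; rewrite /le_bound /gt_bound.
case: unliftP ij => [j' ->|->//] ij; case: unliftP ij => [i' ->|->] ij; last first.
  by move: ij; rewrite ltnNge leq_ord.
move=> h1 h2; apply: leq_ltn_trans h2 _; apply: leq_ltn_trans h1.
move: ij; rewrite lift_max lift0 ltnS leq_eqVlt => /predU1P[/ord_inj -> //|].
by move=> /(wcoord_lt x)/ltnW.
Qed.

Local Notation Phi v n := (\sum_(z < n) T v z).
Definition Pmat (n : nat) : 'M[R[i]]_N.+1 :=
  \matrix_(i, j) \sum_(v < n | slot j v) T (wcoord y i) v.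
Definition Cmat (n : nat) : 'M[R[i]]_N.+1 :=
  \matrix_(i, j) \sum_(v < n | le_bound j v) T (wcoord y i) v.
Definition Clim : 'M[R[i]]_N.+1 :=
  \matrix_(i, j) (if unlift ord_max j is Some j' then Phi (wcoord y i) (wcoord x j').+1 else 1).
Local Notation cprod := (\prod_(i < N) (ac (wcoord x i))^-1).

(** As [x] is increasing, the sets of values allowed by [le_bound] are nested, and a slot is the
    difference of two consecutive ones. *)
Lemma det_Pmat n : \det (Pmat n) = \det (Cmat n).
Proof.
apply: det_col_differences => [i|i j]; rewrite !mxE.
  by apply: eq_bigl => v; rewrite /slot /gt_bound unlift_none andbT.
rewrite [in RHS](bigID (fun v : 'I_n => (v <= wcoord x j)%N)) /=.
have -> : \sum_(v < n | le_bound (lift ord0 j) v && (v <= wcoord x j)%N) T (wcoord y i) v =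
    \sum_(v < n | le_bound (widen j) v) T (wcoord y i) v.
  apply: eq_bigl => v; rewrite -lift_max_widen /le_bound liftK.
  case: unliftP => [j'|_//] E; apply: andb_idl => vj.
  apply: leq_trans vj _; apply/ltnW/(wcoord_lt x).
  by have := congr1 val E; rewrite [val _]lift0 [val (lift ord_max _)]lift_max => <-.
rewrite addrC addrK; apply: eq_bigl => v.
by rewrite /slot /gt_bound liftK ltnNge.
Qed.

Lemma Cmat_last n i : Cmat n i ord_max = Phi (wcoord y i) n.
Proof. by rewrite mxE; apply: eq_bigl => v; rewrite /le_bound unlift_none. Qed.

Lemma Cmat_lift n i (j : 'I_N) : (wcoord x j < n)%N ->
  Cmat n i (lift ord_max j) = Clim i (lift ord_max j).
Proof.
move=> xn; rewrite !mxE liftK.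
rewrite (big_ord_widen_cond n xpredT (T (wcoord y i)) xn) /=.
by apply: eq_bigl => v; rewrite /le_bound liftK ltnS.
Qed.

(** Once [n] exceeds all coordinates of [x], truncation is felt in the last column only. Its
    cofactors are then constant, and the limit is that of the row sums of [T]. *)
Lemma det_Cmat_ctends : ctends (fun n => \det (Cmat n)) (\det Clim).
Proof.
rewrite (@expand_det_last_col _ _ Clim (fun=> 1)); last by move=> i; rewrite mxE unlift_none.
apply: (@ctends_eventually _ (fun n => \sum_i cofactor Clim i ord_max * Phi (wcoord y i) n) _ _
    (\max_(i < N) wcoord x i).+1).
  move=> n nx; rewrite (expand_det_last_col (Cmat_last n)).
  apply: eq_bigr => i _; rewrite mulrC /cofactor; congr (_ * (_ * \det _)).
  apply/matrixP => k l; rewrite !mxE -!/(Clim _ _) -!/(Cmat _ _ _).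
  have := @Cmat_lift n (lift i k) l; rewrite !mxE => -> //.
  by apply: leq_trans nx; rewrite ltnS (leq_bigmax l).
rewrite (eq_bigr (fun i => cofactor Clim i ord_max * 1)); last by move=> i _; rewrite mulrC.
by apply: ctends_sum => i; apply: ctendsZ; exact: T_sum_ctends.
Qed.

Definition FP (z : W N.+1) : R[i] := P_kernel a f gamma y z * Lambda a z x.

Lemma FPE z : FP z = cprod * (\det (\matrix_(i, j) T (wcoord y i) (wcoord z j)) *
  (interlace x z)%:R).
Proof. by rewrite /FP /P_kernel /Lambda; ring. Qed.

Lemma sum_FP n : \sum_(z <- W_upto N.+1 n) FP z = cprod * \det (Cmat n).
Proof.
rewrite -det_Pmat (det_sum_cols (fun j (v : 'I_n) => slot j v) (fun i v => T (wcoord y i) v)).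
rewrite -(sum_W_upto n (fun h => \det (\matrix_(i, j) T (wcoord y i) (h j))) slot_increasing).
rewrite mulr_sumr [RHS]big_mkcond /=; apply: eq_bigr => z _.
by rewrite FPE interlace_slot; case: ifP => _; rewrite ?mulr1 ?mulr0.
Qed.

Lemma FP_bound n : \sum_(z <- W_upto N.+1 n) normc (FP z) <=
  normc cprod * \sum_(t : 'S_N.+1) K ^+ N.+1.
Proof.
apply: le_trans (_ : _ <= \sum_(z <- W_upto N.+1 n) normc cprod *
   normc (\det (\matrix_(i, j) T (wcoord y i) (wcoord z j)))) _.
  apply: ler_sum => z _; rewrite FPE !Normc.normcM ler_wpM2l ?normc_ge0//.
  by case: (interlace x z); rewrite ?Normc.normc1 ?mulr1// Normc.normc0 mulr0 normc_ge0.
by rewrite -mulr_sumr ler_wpM2l ?normc_ge0//; exact: sum_det_norm_le.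
Qed.

Lemma FP_ctends : ctends (fun n => \sum_(z <- W_upto N.+1 n) FP z) (cprod * \det Clim).
Proof.
apply: (@ctends_eventually _ (fun n => cprod * \det (Cmat n)) _ _ 0%N).
  by move=> n _; rewrite sum_FP.
by apply: ctendsZ; exact: det_Cmat_ctends.
Qed.

Definition row_slot (i : 'I_N) (v : nat) :=
  (wcoord y (widen i) <= v < wcoord y (lift ord0 i))%N.
Local Notation n1 := (wcoord y ord_max).

Lemma le_last (i : 'I_N.+1) : (wcoord y i <= n1)%N.
Proof.
have : (i <= (ord_max : 'I_N.+1))%N by exact: leq_ord.
by rewrite leq_eqVlt => /predU1P[/ord_inj -> //|/(wcoord_lt y)/ltnW].
Qed.

Definition Emat : 'M[R[i]]_N :=
  \matrix_(i, j) \sum_(v < n1 | row_slot i v) (ac v)^-1 * T v (wcoord x j).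

Lemma Phi_difference (u v m : nat) : (u <= v)%N ->
  Phi v m.+1 - Phi u m.+1 = - ac m * \sum_(u <= z < v) (ac z)^-1 * T z m.
Proof.
move=> uv; rewrite -(telescope_sumr (fun u => Phi u m.+1) uv) mulr_sumr.
by apply: eq_bigr => z _; rewrite T_row_sum; ring.
Qed.

(** Each row difference carries a factor [- a] at the coordinate [x j] of its column. The signs
    cancel the [(-1) ^+ N] of [det_row_differences], and the factors [a] cancel [cprod]. *)
Lemma det_Clim : cprod * \det Clim = \det Emat.
Proof.
rewrite det_row_differences; last by move=> i; rewrite mxE unlift_none.
rewrite (_ : \matrix_(i, j) _ = Emat *m diag_mx (\row_j - ac (wcoord x j))); last first.
  apply/matrixP => i j; rewrite mul_mx_diag !mxE -lift_max_widen liftK.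
  rewrite Phi_difference; last first.
    by apply/ltnW/(wcoord_lt y); rewrite lift0.
  rewrite mulrC; congr (_ * _).
  rewrite (big_nat_widenl _ 0%N)// (big_nat_widen _ _ n1) ?le_last// big_mkord.
  by apply: eq_bigl => v.
have D : \det (diag_mx (\row_j - ac (wcoord x j))) = (-1) ^+ N * \prod_(i < N) ac (wcoord x i).
  rewrite det_diag (eq_bigr (fun i => - ac (wcoord x i))) => [|i _]; last by rewrite mxE.
  by rewrite prodrN; congr (_ ^+ _ * _); exact: card_ord.
rewrite det_mulmx D prodfV; set P := \prod_(i < N) _.
have P0 : P != 0 by apply/prodf_neq0 => i _; exact: a0.
rewrite mulrCA [P^-1 * _]mulrCA [P^-1 * _]mulrCA mulVf// mulr1.
by rewrite mulrCA -expr2 sqrr_sign mulr1.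
Qed.

Lemma row_slot_increasing (h : 'I_N -> nat) : (forall i, row_slot i (h i)) ->
  forall i j : 'I_N, (i < j)%N -> (h i < h j)%N.
Proof.
move=> H i j ij; have /andP[_ h1] := H i; have /andP[h2 _] := H j.
apply: leq_trans h1 _; apply: leq_trans h2.
have : (lift ord0 i <= widen j)%N by rewrite lift0.
by rewrite leq_eqVlt => /predU1P[/ord_inj -> //|/(wcoord_lt y)/ltnW].
Qed.

Definition FL (z : W N) : R[i] := Lambda a y z * P_kernel a f gamma z x.

Lemma sum_FL : \sum_(z <- W_upto N n1) FL z = \det Emat.
Proof.
rewrite (det_sum_rows (fun i (v : 'I_n1) => row_slot i v)
  (fun i v j => (ac v)^-1 * T v (wcoord x j))).
rewrite -(sum_W_upto n1 (fun h => \det (\matrix_(i, j) ((ac (h i))^-1 * T (h i) (wcoord x j))))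
  row_slot_increasing).
rewrite [RHS]big_mkcond /=; apply: eq_bigr => z _.
rewrite /FL /Lambda /P_kernel mulrAC -[X in if X then _ else _]/(interlace z y).
case: (interlace z y); rewrite ?mulr0 ?mulr1//.
rewrite [in RHS](_ : \matrix_(i, j) (_ * _) =
  diag_mx (\row_i (ac (wcoord z i))^-1) *m \matrix_(i, j) T (wcoord z i) (wcoord x j)).
  rewrite det_mulmx det_diag; congr (_ * _).
  by apply: eq_bigr => i _; rewrite mxE.
by apply/matrixP => i j; rewrite mul_diag_mx !mxE.
Qed.

(** Interlacing keeps every coordinate of [z] below the last one of [y], so this side is a finite
    sum and involves no limit. *)
Lemma FL_supp z : FL z != 0 -> z \in W_upto N n1.
Proof.
rewrite /FL /Lambda mem_W_upto => H.
have /forallP I : interlace z y.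
  by apply: contraNT H => /negbTE ->; rewrite mulr0 mul0r.
apply/forallP => i; have /andP[_ h] := I i.
exact: leq_trans h (le_last _).
Qed.

Theorem kernel_intertwining :
  [/\ summable [set: W N.+1] (fun z => (normc (FP z))%:E),
      summable [set: W N] (fun z => (normc (FL z))%:E) &
      summability.sum (FP : W N.+1 -> R[i]^o) = summability.sum (FL : W N -> R[i]^o)].
Proof.
have [sL ->] := finite_unordered_sum (W_upto_uniq N n1) FL_supp.
rewrite sum_FL -det_Clim; split=> //.
  exact: (summable_exhaustion (@W_upto_uniq _) (@W_upto_sub _)
    (fun z _ => W_upto_supp z) FP_bound).
exact: (sum_exhaustion (@W_upto_uniq _) (@W_upto_sub _)
    (fun z _ => W_upto_supp z) FP_bound FP_ctends).
Qed.

End Intertwining.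

Unset Implicit Arguments.
Set Strict Implicit.

Theorem theorem4p6 (R : realType)
  (a : nat -> R)
  (a_inf : (0 < ereal_inf (range (fun x => (a x)%:E)))%E)
  (a_sup : (ereal_sup (range (fun x => (a x)%:E)) < +oo)%E)
  (N : nat) (N_ge1 : (1 <= N)%N)
  (eps : R) (eps_gt0 : 0 < eps)
  (f : R[i] -> R[i])
  (f_holo : holomorphic_on (right_half_plane eps) f)
  (f0 : f 0 = 1)
  (gamma : R -> R[i])
  (gamma_contour : simple_closed_contour gamma)
  (gamma_sub : curve_image gamma `<=` right_half_plane eps)
  (gamma_a : forall x, positively_encircles gamma ((a x)%:C)) :
  [/\ kernel_composable (P_kernel a f gamma (N := N.+1)) (Lambda a (N := N)),
      kernel_composable (Lambda a (N := N)) (P_kernel a f gamma (N := N)) &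
      forall (y : W N.+1) (x : W N),
        kernel_comp (P_kernel a f gamma (N := N.+1)) (Lambda a (N := N)) y x =
        kernel_comp (Lambda a (N := N)) (P_kernel a f gamma (N := N)) y x].
Proof.
have [gammaC1 gamma_closed _] := gamma_contour.
have a_gt0 x : 0 < a x.
  by rewrite -lte_fin; apply: lt_le_trans a_inf _; apply: ereal_inf_lbound; exists x.
have [M a_leM] : exists M, forall x, a x <= M.
  have aM x : ((a x)%:E <= ereal_sup (range (fun x => (a x)%:E)))%E.
    by apply: ereal_sup_ubound; exists x.
  (* A finite supremum is the bound sought, an infinite one contradicts [a_sup], and minus infinity
     cannot lie above [a 0]. *)
  move: a_sup aM; case: (ereal_sup _) => [M _ aM|//|_ aM].
    by exists M => x; rewrite -lee_fin.
  by have := aM 0%N; rewrite leeNy_eq.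
have [K [s [K0 /andP[s0 s1] J0 T_le T_sum]]] := T_kernel_stochastic a_gt0 a_leM gammaC1
  gamma_closed gamma_a gamma_sub eps_gt0 f_holo.
have fc := holomorphic_con_curve gammaC1 gamma_sub f_holo.
have T_row x m := T_kernel_row_sum a_gt0 gammaC1 gamma_a m fc (J0 x).
rewrite f0 in T_sum.
have main y x := kernel_intertwining a_gt0 K0 s0 s1 T_le T_sum T_row y x.
by split=> [y x|y x|y x]; have [] := main N y x.
Qed.
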